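(* Let $\mathcal T$ be a right tensor $C^*$-precategory and let $\mathcal J\subset\mathcal K$ be ideals in $\mathcal T$. For every $r\in\mathbb N$, $k\in\mathbb Z$ with $r+k\ge0$, the formula $$\|a\|^{\mathcal J}_{r+k,r}:=\max\Big\{\max_{s=0,\dots,r-1}\Big\|q_{\mathcal J}\Big(\sum_{i=0,\ i+k\ge0}^{s}a_{i+k,i}\otimes1^{s-i}\Big)\Big\|,\ \Big\|\sum_{i=0,\ i+k\ge0}^{r}a_{i+k,i}\otimes1^{r-i}\Big\|\Big\}$$ defines a seminorm on $\mathcal M(r+k,r)$, such that the family of quotient spaces $$\mathcal K_{\mathcal J}:=\{\mathcal M(n,m)/\|\cdot\|^{\mathcal J}_{n,m}\}_{n,m\in\mathbb N}$$ forms a right tensor $C^*$-precategory (with composition and involution induced by those of $\mathcal M_{\mathcal T}(\mathcal K)$) with a right tensoring $\otimes_{\mathcal J}1$ induced by the inclusions $\mathcal M(n,m)\subset\mathcal M(n+1,m+1)$, $n,m\in\mathbb N$. Moreover, the right tensoring $\otimes_{\mathcal J}1$ is faithful if and only if $\mathcal J\subset(\ker\otimes1)^\perp$.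
   Context: $\mathbb N=\{0,1,2,\dots\}$. A $C^*$-precategory $\mathcal T$ with object set $\mathbb N$ consists of complex Banach spaces $\mathcal T(n,m)$, bilinear associative compositions $\mathcal T(n,m)\times\mathcal T(m,l)\to\mathcal T(n,l)$ with $\|ab\|\le\|a\|\|b\|$, and antilinear involutive maps $*:\mathcal T(n,m)\to\mathcal T(m,n)$ with $(ab)^*=b^*a^*$ and $\|a^*a\|=\|a\|^2$. An ideal $\mathcal K$ in $\mathcal T$ is a family of closed subspaces $\mathcal K(n,m)\subset\mathcal T(n,m)$ with $\mathcal T(n,m)\mathcal K(m,l)\subset\mathcal K(n,l)$ and $\mathcal K(n,m)\mathcal T(m,l)\subset\mathcal K(n,l)$; inclusions are entrywise. $\mathcal T/\mathcal J$ is the $C^*$-precategory with spaces $\mathcal T(n,m)/\mathcal J(n,m)$, and $q_{\mathcal J}:\mathcal T\to\mathcal T/\mathcal J$ is the quotient map. A right tensor $C^*$-precategory is a $C^*$-precategory with object set $\mathbb N$ and linear maps $\otimes1:\mathcal T(n,m)\to\mathcal T(n+1,m+1)$, $a\mapsto a\otimes1$, with $(ab)\otimes1=(a\otimes1)(b\otimes1)$, $(a^* )\otimes1=(a\otimes1)^*$; $a\otimes1^k$ is the $k$-th iterate ($\otimes 1^0=\mathrm{id}$). It is faithful if all these maps are injective. $\ker\otimes1$ is the ideal of morphisms with $a\otimes1=0$. For an ideal $\mathcal I$, $\mathcal I^\perp$ is the unique ideal in $\mathcal T$ with $\mathcal I^\perp(n,n)=\{a\in\mathcal T(n,n):a\,\mathcal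 I(n,n)=0\}$ for all $n$. $\mathcal M_{\mathcal T}(\mathcal K)$ is the set of matrices $\{a_{n,m}\}_{n,m\in\mathbb N}$ with $a_{n,m}\in\mathcal K(n,m)$, finitely many nonzero, with entrywise linear structure, involution $(a^* )_{n,m}=(a_{m,n})^*$, and the bilinear product $\star$ determined as follows: writing $\iota^{\mathcal M}_{n,m}(a)$ for the matrix with single entry $a$ at place $(n,m)$, $\iota^{\mathcal M}_{n,m}(a)\star\iota^{\mathcal M}_{p,l}(b)$ equals $\iota^{\mathcal M}_{n+p-m,\,l}((a\otimes1^{p-m})b)$ if $m\le p$ and $\iota^{\mathcal M}_{n,\,l+m-p}(a(b\otimes1^{m-p}))$ if $p<m$. This is a $*$-algebra. For $r\in\mathbb N$, $k\in\mathbb Z$, $r+k\ge0$, $$\mathcal M(r+k,r):=\{a\in\mathcal M_{\mathcal T}(\mathcal K): a_{n,m}\ne0\Rightarrow n-m=k,\ m\le r\}.$$ $\mathcal M(n,m)/\|\cdot\|$ denotes the quotient by the subspace of elements of seminorm zero, with the induced norm. *)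

(* Defs.v *)
From HB Require Import structures.
From mathcomp Require Import all_boot all_order all_algebra.
From mathcomp Require Import complex.
From mathcomp Require Import all_classical all_reals all_analysis.

Set Implicit Arguments.
Unset Strict Implicit.
Unset Printing Implicit Defensive.

Import Order.TTheory GRing.Theory Num.Theory.
Import numFieldNormedType.Exports.

Local Open Scope classical_set_scope.
Local Open Scope ring_scope.

(* MathComp norms on an R[i]-module take (real) values in R[i]; [nrm] is the
   same norm with values in R. *)
Definition nrm (R : realType) (V : normedModType R[i]) (x : V) : R :=
  complex.Re `|x|.

Record seminorm (R : realType) (V : lmodType R[i]) (p : V -> R) : Prop :=
  Seminorm {
    seminormD : forall x y, p (x + y) <= p x + p y ;
    seminormZ : forall (c : R[i]) x, p (c *: x) = complex.Re `|c| * p x }.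

Section SeminormQuotient.
Variables (R : realType) (V : lmodType R[i]) (p : V -> R).
Hypothesis hp : seminorm p.

Lemma seminorm0 : p 0 = 0.
Proof. by rewrite -(scale0r (0 : V)) (seminormZ hp) normr0 mul0r. Qed.

Lemma seminormN x : p (- x) = p x.
Proof. by rewrite -scaleN1r (seminormZ hp) normrN1 mul1r. Qed.

Lemma seminorm_ge0 x : 0 <= p x.
Proof.
have := seminormD hp x (- x); rewrite subrr seminorm0 seminormN -mulr2n.
by rewrite pmulrn_lge0.
Qed.

Definition seminorm_null of seminorm p : {pred V} := [pred x | p x == 0].

Lemma seminorm_null_submod : submod_closed (seminorm_null hp).
Proof.
split=> [|c x y]; rewrite !inE ?seminorm0 // => /eqP px /eqP py.
rewrite eq_le seminorm_ge0 andbT (le_trans (seminormD hp _ _)) //.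
by rewrite (seminormZ hp) px py mulr0 addr0.
Qed.

HB.instance Definition _ :=
  GRing.isSubmodClosed.Build R[i] V (seminorm_null hp) seminorm_null_submod.

(* V / {x | p x = 0} *)
Definition seminorm_quot := {ideal_quot (seminorm_null hp)}.

HB.instance Definition _ := GRing.Zmodule.on seminorm_quot.

Definition seminorm_class (x : V) : seminorm_quot := (\pi x)%qT.

Definition seminorm_quot_scale (c : R[i]) (u : seminorm_quot) : seminorm_quot :=
  seminorm_class (c *: repr u).

Definition seminorm_quot_norm (u : seminorm_quot) : R[i] := (p (repr u))%:C%C.

Lemma seminorm_class_eqP x y : seminorm_class x = seminorm_class y <-> p (x - y) = 0.
Proof.
split=> [/eqP|pxy]; first by rewrite -Quotient.idealrBE => /eqP.
by apply/eqP; rewrite -Quotient.idealrBE; apply/eqP.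
Qed.

Lemma seminorm_class_repr u : seminorm_class (repr u) = u.
Proof. exact: reprK. Qed.

Lemma seminorm_classD x y :
  seminorm_class (x + y) = seminorm_class x + seminorm_class y.
Proof. exact: (raddfD (\pi_seminorm_quot)%qT). Qed.

Lemma seminorm_quot_scaleE c x :
  seminorm_quot_scale c (seminorm_class x) = seminorm_class (c *: x).
Proof.
apply/seminorm_class_eqP; rewrite -scalerBr (seminormZ hp).
have /seminorm_class_eqP -> := seminorm_class_repr (seminorm_class x).
by rewrite mulr0.
Qed.

Lemma seminorm_quot_normE x : seminorm_quot_norm (seminorm_class x) = (p x)%:C%C.
Proof.
have /seminorm_class_eqP h := seminorm_class_repr (seminorm_class x).
congr (_%:C)%C; apply/eqP; rewrite eq_le; apply/andP; split.
  rewrite -[X in p X <= _](subrK x) (le_trans (seminormD hp _ _)) //.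
  by rewrite h add0r.
rewrite -[X in p X <= _](subrK (repr (seminorm_class x))).
rewrite (le_trans (seminormD hp _ _)) //.
by rewrite -[p (x - _)]seminormN opprB h add0r.
Qed.

Fact seminorm_quot_scaleA a b u :
  seminorm_quot_scale a (seminorm_quot_scale b u) =
  seminorm_quot_scale (a * b) u.
Proof.
by rewrite -(seminorm_class_repr u) !seminorm_quot_scaleE scalerA.
Qed.
Fact seminorm_quot_scale1 : left_id 1 seminorm_quot_scale.
Proof.
by move=> u; rewrite -(seminorm_class_repr u) seminorm_quot_scaleE scale1r.
Qed.
Fact seminorm_quot_scaleDr : right_distributive seminorm_quot_scale +%R.
Proof.
move=> c u v; rewrite -(seminorm_class_repr u) -(seminorm_class_repr v).
by rewrite -seminorm_classD !seminorm_quot_scaleE -seminorm_classD scalerDr.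
Qed.
Fact seminorm_quot_scaleDl u :
  {morph seminorm_quot_scale^~ u : a b / a + b}.
Proof.
move=> a b; rewrite -(seminorm_class_repr u).
by rewrite !seminorm_quot_scaleE -seminorm_classD scalerDl.
Qed.

HB.instance Definition _ :=
  GRing.Zmodule_isLmodule.Build R[i] seminorm_quot seminorm_quot_scaleA
    seminorm_quot_scale1 seminorm_quot_scaleDr seminorm_quot_scaleDl.

Fact seminorm_quot_normD u v :
  seminorm_quot_norm (u + v) <= seminorm_quot_norm u + seminorm_quot_norm v.
Proof.
rewrite -(seminorm_class_repr u) -(seminorm_class_repr v) -seminorm_classD.
by rewrite !seminorm_quot_normE -rmorphD lecR (seminormD hp).
Qed.
Fact seminorm_quot_normZ (c : R[i]) u :
  seminorm_quot_norm (c *: u) = `|c| * seminorm_quot_norm u.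
Proof.
rewrite -(seminorm_class_repr u) [c *: _]seminorm_quot_scaleE.
by rewrite !seminorm_quot_normE (seminormZ hp) rmorphM.
Qed.
Fact seminorm_quot_norm_eq0 u : seminorm_quot_norm u = 0 -> u = 0.
Proof.
rewrite -(seminorm_class_repr u) seminorm_quot_normE => /complexI pu.
have -> : 0 = seminorm_class 0 by rewrite [RHS](raddf0 (\pi_seminorm_quot)%qT).
by apply/seminorm_class_eqP; rewrite subr0.
Qed.

HB.instance Definition _ :=
  Lmodule_isNormed.Build R[i] seminorm_quot seminorm_quot_normD
    seminorm_quot_normZ seminorm_quot_norm_eq0.

End SeminormQuotient.

Record cstar_precat (R : realType) (H : nat -> nat -> normedModType R[i]) :=
  CstarPrecat {
    hcomp : forall n m l, H n m -> H m l -> H n l ;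
    hstar : forall n m, H n m -> H m n ;
    homs_complete : forall n m (F : set_system (H n m)),
      ProperFilter F -> cauchy F -> cvg F ;
    hcomp_linearl : forall n m l (c : R[i]) (a a' : H n m) (b : H m l),
      hcomp (c *: a + a') b = c *: hcomp a b + hcomp a' b ;
    hcomp_linearr : forall n m l (c : R[i]) (a : H n m) (b b' : H m l),
      hcomp a (c *: b + b') = c *: hcomp a b + hcomp a b' ;
    hcompA : forall n m l k (a : H n m) (b : H m l) (d : H l k),
      hcomp a (hcomp b d) = hcomp (hcomp a b) d ;
    hcomp_norm : forall n m l (a : H n m) (b : H m l),
      `|hcomp a b| <= `|a| * `|b| ;
    hstar_antilinear : forall n m (c : R[i]) (a b : H n m),
      hstar (c *: a + b) = c^* *: hstar a + hstar b ;
    hstarK : forall n m (a : H n m), hstar (hstar a) = a ;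
    hstar_comp : forall n m l (a : H n m) (b : H m l),
      hstar (hcomp a b) = hcomp (hstar b) (hstar a) ;
    cstar_identity : forall n m (a : H n m),
      `|hcomp (hstar a) a| = `|a| ^+ 2 }.

Record right_tensoring (R : realType) (H : nat -> nat -> normedModType R[i])
    (T : cstar_precat H) := RightTensoring {
  tens : forall n m, {linear H n m -> H n.+1 m.+1} ;
  tens_hcomp : forall n m l (a : H n m) (b : H m l),
    tens n l (hcomp T a b) = hcomp T (tens n m a) (tens m l b) ;
  tens_hstar : forall n m (a : H n m),
    tens m n (hstar T a) = hstar T (tens n m a) }.

Section RightTensorPrecategory.
Variables (R : realType) (H : nat -> nat -> normedModType R[i]).
Variables (T : cstar_precat H) (t : right_tensoring T).

Definition faithful := forall n m, injective (tens t n m).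

Definition subfamily := forall n m, set (H n m).

Definition sub_le (I J : subfamily) := forall n m, I n m `<=` J n m.

Record is_ideal (I : subfamily) : Prop := IsIdeal {
  ideal_closed : forall n m, closed (I n m) ;
  ideal0 : forall n m, I n m 0 ;
  ideal_linear : forall n m (c : R[i]) (a b : H n m),
    I n m a -> I n m b -> I n m (c *: a + b) ;
  ideal_compl : forall n m l (a : H n m) (b : H m l),
    I m l b -> I n l (hcomp T a b) ;
  ideal_compr : forall n m l (a : H n m) (b : H m l),
    I n m a -> I n l (hcomp T a b) }.

Record ideal := Ideal { ideal_val :> subfamily ; idealP : is_ideal ideal_val }.

Definition ker_tens : subfamily := fun n m => [set a | tens t n m a = 0].

(* Definite description of the unique ideal with the given diagonal. *)
Definition perp (I : subfamily) : subfamily :=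
  xget (fun _ _ => set0) [set P : subfamily | is_ideal P /\
    forall n, P n n = [set a | forall b, I n n b -> hcomp T a b = 0]].

(* The norm of the image of x in the quotient H n m / J n m. *)
Definition quotient_norm (J : subfamily) n m (x : H n m) : R :=
  inf [set nrm (x + y) | y in J n m].

Fixpoint tens_iter k n m : H n m -> H (k + n)%N (k + m)%N :=
  match k with
  | 0 => id
  | k'.+1 => fun a => tens t (k' + n)%N (k' + m)%N (tens_iter k' a)
  end.

Definition matr := forall n m, H n m.

End RightTensorPrecategory.

Section Matrices.
Variables (R : realType) (H : nat -> nat -> normedModType R[i]).

HB.instance Definition _ := gen_eqMixin (matr H).
HB.instance Definition _ := gen_choiceMixin (matr H).

Definition matr_add (a b : matr H) : matr H := fun n m => a n m + b n m.
Definition matr_opp (a : matr H) : matr H := fun n m => - a n m.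
Definition matr_zero : matr H := fun n m => 0.
Definition matr_scale (c : R[i]) (a : matr H) : matr H := fun n m => c *: a n m.

Lemma matrP (a b : matr H) : (forall n m, a n m = b n m) -> a = b.
Proof. by move=> ab; apply: functional_extensionality_dep => n;
  apply: functional_extensionality_dep => m. Qed.

Fact matr_addA : associative matr_add.
Proof. by move=> *; apply: matrP => n m; exact: addrA. Qed.
Fact matr_addC : commutative matr_add.
Proof. by move=> *; apply: matrP => n m; exact: addrC. Qed.
Fact matr_add0 : left_id matr_zero matr_add.
Proof. by move=> *; apply: matrP => n m; exact: add0r. Qed.
Fact matr_addN : left_inverse matr_zero matr_opp matr_add.
Proof. by move=> *; apply: matrP => n m; exact: addNr. Qed.

HB.instance Definition _ :=
  GRing.isZmodule.Build (matr H) matr_addA matr_addC matr_add0 matr_addN.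

Fact matr_scaleA c d a : matr_scale c (matr_scale d a) = matr_scale (c * d) a.
Proof. by apply: matrP => n m; exact: scalerA. Qed.
Fact matr_scale1 : left_id 1 matr_scale.
Proof. by move=> *; apply: matrP => n m; exact: scale1r. Qed.
Fact matr_scaleDr : right_distributive matr_scale +%R.
Proof. by move=> *; apply: matrP => n m; exact: scalerDr. Qed.
Fact matr_scaleDl a : {morph matr_scale^~ a : c d / c + d}.
Proof. by move=> *; apply: matrP => n m; exact: scalerDl. Qed.

HB.instance Definition _ :=
  GRing.Zmodule_isLmodule.Build R[i] (matr H)
    matr_scaleA matr_scale1 matr_scaleDr matr_scaleDl.

(* The matrix with single entry x at place (n, m). It also serves as a cast:
   if n = u and m = v hold propositionally, [single x u v : H u v] is x. *)
Definition single n m (x : H n m) : matr H := fun u v =>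
  match n =P u, m =P v with
  | ReflectT nu, ReflectT mv => ecast u (H u v) nu (ecast v (H n v) mv x)
  | _, _ => 0
  end.

Variables (T : cstar_precat H) (t : right_tensoring T).

Definition matr_star (a : matr H) : matr H := fun n m => hstar T (a m n).

(* iota_{n,m}(x) * iota_{p,l}(y). The inner [single] is a cast: it rewrites
   (p - m) + n and (p - m) + m as n + p - m and p when m <= p, and
   (m - p) + p and (m - p) + l as m and l + m - p when p < m. *)
Definition single_mul n m p l (x : H n m) (y : H p l) : matr H :=
  if (m <= p)%N
  then single (hcomp T (single (tens_iter t (p - m) x) (n + p - m)%N p) y)
  else single (hcomp T x (single (tens_iter t (m - p) y) m (l + m - p)%N)).

(* The bilinear extension of [single_mul]; for finitely supported a, b the sum
   has finitely many nonzero terms. *)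
Definition matr_mul (a b : matr H) : matr H := fun u v =>
  \sum_(i \in [set: (nat * nat) * (nat * nat)])
    single_mul (a i.1.1 i.1.2) (b i.2.1 i.2.2) u v.

Variable K : ideal T.

Definition in_MT (a : matr H) :=
  (forall i j, (K : subfamily H) i j (a i j)) /\
  finite_set [set ij : nat * nat | a ij.1 ij.2 != 0].

(* M(n, m), that is M(r + k, r) for r = m and k = n - m. *)
Definition graded (n m : nat) : {pred matr H} := fun a =>
  `[< in_MT a /\ forall i j, a i j != 0 ->
        i%:Z - j%:Z = n%:Z - m%:Z /\ (j <= m)%N >].

Lemma graded_submod n m : submod_closed (graded n m).
Proof.
split=> [|c a b /asboolP[[aK af] ah] /asboolP[[bK bf] bh]]; apply/asboolP.
  split; last by move=> i j; rewrite eqxx.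
  split=> [i j|]; first exact: (ideal0 (idealP K)).
  by rewrite (_ : [set _ | _] = set0) // -subset0 => x /=; rewrite eqxx.
have cab i j : (c *: a + b) i j != 0 -> a i j != 0 \/ b i j != 0.
  have -> : (c *: a + b) i j = c *: a i j + b i j by [].
  have [->|] := eqVneq (a i j) 0; last by left.
  by rewrite scaler0 add0r; right.
split; last by move=> i j /cab[/ah|/bh].
split=> [i j|]; first exact: (ideal_linear (idealP K)).
apply: (@sub_finite_set _ _ ([set ij : nat * nat | a ij.1 ij.2 != 0] `|`
  [set ij : nat * nat | b ij.1 ij.2 != 0])); last by rewrite finite_setU.
by move=> ij /cab.
Qed.

HB.instance Definition _ n m :=
  GRing.isSubmodClosed.Build R[i] (matr H) (graded n m) (graded_submod n m).

Record Mspace (n m : nat) := MSpace { mx :> matr H ; mxP : mx \in graded n m }.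

HB.instance Definition _ n m := [isSub for @mx n m].
HB.instance Definition _ n m := [Choice of Mspace n m by <:].
HB.instance Definition _ n m := [SubChoice_isSubLmodule of Mspace n m by <:].

(* \sum_(0 <= i <= s, 0 <= i + k) a_{i+k,i} (x) 1^(s-i), in H (s + k) s.
   The sum is empty if s + k < 0; otherwise [absz] only turns i + k, s + k >= 0
   into naturals and [single] is a cast. *)
Definition diag_sum (k : int) (s : nat) (a : matr H) : H (absz (s%:Z + k)) s :=
  \sum_(i < s.+1 | 0 <= i%:Z + k)
    single (tens_iter t (s - i) (a (absz (i%:Z + k)) i)) (absz (s%:Z + k)) s.

(* ||a||^J_{r+k,r} with r = m and k = n - m. *)
Definition norm_J (J : ideal T) (n m : nat) (a : Mspace n m) : R :=
  let k := n%:Z - m%:Z in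
  Num.max (\big[Num.max/0]_(s < m) quotient_norm J (diag_sum k s (mx a)))
          (nrm (diag_sum k m (mx a))).

Definition K_J (J : ideal T)
    (hN : forall n m, seminorm (@norm_J J n m)) (n m : nat) :
    normedModType R[i] :=
  seminorm_quot (hN n m).

End Matrices.

(* Main.v *)
Require Import Defs.
From HB Require Import structures.
From mathcomp Require Import all_boot all_order all_algebra.
From mathcomp Require Import complex ring lra zify.
From mathcomp Require Import all_classical all_reals all_analysis.

Set Implicit Arguments.
Unset Strict Implicit.
Unset Printing Implicit Defensive.

Import Order.TTheory GRing.Theory Num.Theory.
Import numFieldNormedType.Exports.

Local Open Scope classical_set_scope.
Local Open Scope ring_scope.

(* A finitely supported matrix a on a diagonal is encoded by its partial sums
   x_s = \sum_(i <= s) a_(i+k,i) (x) 1^(s-i), and Abel summation turns the product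
   of matrices into the entrywise product of partial sums. Hence ||.||^J is the
   norm of (q_J(x_0), ..., q_J(x_(r-1)), x_r), and the algebraic axioms and the
   C*-identity are inherited from T and T/J.

   Completeness, self-adjointness of ideals, the C*-identity in T/J and
   contractivity of (x) 1 need C*-theory. Positivity of a^* a for a in T(n,m) is
   not an axiom, so everything is done with h = a^* a self-adjoint and h^2. In the
   unitization, p^2 + q^2 = |p + iq|^2 gives ||p||^2 <= ||p^2 + q^2|| for commuting
   self-adjoint p, q. With 1 - h^2 = w^2 this yields ||1 - h^2|| <= 1 for
   ||h|| <= 1, so R = (1 + c h^2)^-1 is approximated by its Neumann series, and
   R^2 + c (hR)^2 = R bounds both R and hR. Then c h^2 R is an approximate unit,
   and x |-> x R, with h = x^* x, truncates x: it sends x to an element of norm at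
   most 2 which is close to x modulo J when ||q_J(x)|| < 1. Applied to the partial
   sums it lifts Cauchy sequences for ||.||^J to norm convergent ones.

   A partial sum killed by one more tensoring lies in J and in ker (x) 1, which
   explains the faithfulness criterion. *)

(** * Norms and compositions *)

Section NormedBasics.
Variables (R : realType) (V : normedModType R[i]).
Implicit Types (x y : V) (A : set V).

Lemma nrmE x : `|x| = (nrm x)%:C%C.
Proof. by rewrite /nrm RRe_real //; exact: normr_real. Qed.

Lemma nrm_ge0 x : 0 <= nrm x.
Proof. by rewrite -lecR -nrmE; exact: normr_ge0. Qed.

Lemma nrmD x y : nrm (x + y) <= nrm x + nrm y.
Proof. by rewrite -lecR rmorphD /= -!nrmE ler_normD. Qed.

Lemma nrmZ (c : R[i]) x : nrm (c *: x) = complex.Re `|c| * nrm x.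
Proof.
have cE : (complex.Re `|c|)%:C%C = `|c| by apply: RRe_real; exact: normr_real.
by rewrite /nrm normrZ -cE nrmE -rmorphM.
Qed.

Lemma nrmZR (c : R) x : 0 <= c -> nrm (c%:C%C *: x) = c * nrm x.
Proof. by move=> c0; rewrite nrmZ ger0_norm ?lecR. Qed.

Lemma nrm0 : nrm (0 : V) = 0.
Proof. by rewrite /nrm normr0. Qed.

Lemma nrmN x : nrm (- x) = nrm x.
Proof. by rewrite /nrm normrN. Qed.

Lemma nrmB x y : nrm (x - y) = nrm (y - x).
Proof. by rewrite -nrmN opprB. Qed.

Lemma nrm_le0 x : nrm x <= 0 -> x = 0.
Proof.
move=> x0; apply/normr0_eq0; rewrite nrmE.
by have -> : nrm x = 0 by apply: le_anti; rewrite x0 nrm_ge0.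
Qed.

Lemma nrm_ltP x (e : R) : (`|x| < e%:C%C) = (nrm x < e).
Proof. by rewrite nrmE ltcR. Qed.

(** Positive elements of [R[i]] are real, so radii of balls can be taken in [R]. *)
Lemma gt0_complex (e : R[i]) : 0 < e -> exists2 d : R, 0 < d & e = d%:C%C.
Proof.
move=> e0; exists (complex.Re e); last by rewrite RRe_real // gtr0_real.
by rewrite -ltcR RRe_real // gtr0_real.
Qed.

Lemma closed_approx A x : closed A ->
  (forall e : R, 0 < e -> exists2 y, A y & nrm (x - y) <= e) -> A x.
Proof.
move=> Acl Ax; apply: Acl => B /nbhs_ballP[_ /= /gt0_complex[d d0 ->] dB].
have d20 : 0 < d / 2 by rewrite divr_gt0.
have [y Ay xy] := Ax _ d20; exists y; split=> //; apply: dB.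
rewrite -ball_normE /= nrm_ltP (le_lt_trans xy) //.
by rewrite ltr_pdivrMr // mulr2n mulrDr mulr1 ltrDl.
Qed.

Lemma approx_closed A :
  (forall x, (forall e : R, 0 < e -> exists2 y, A y & nrm (x - y) <= e) -> A x) ->
  closed A.
Proof.
move=> h x clx; apply: h => e e0.
have [|y [Ay]] := clx (ball x e%:C%C); first by apply: nbhsx_ballx; rewrite ltcR.
by rewrite -ball_normE /= nrm_ltP => xy; exists y => //; rewrite ltW.
Qed.

(** The method of majorants: a scalar sequence with supremum [L] controls the increments, and its
    own error [L - c k] becomes an explicit rate of convergence. *)
Lemma dominated_increments_cvg (u : nat -> V) (c : R ^nat) (L : R) :
  (forall F : set_system V, ProperFilter F -> cauchy F -> cvg F) ->
  (forall k, nrm (u k.+1 - u k) <= c k.+1 - c k) ->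
  (forall e, 0 < e -> exists k, L - c k <= e) -> (forall k, c k <= L) ->
  exists l, forall k, nrm (l - u k) <= L - c k.
Proof.
move=> Vc uc cL cleL.
have ucD k j : nrm (u (k + j)%N - u k) <= c (k + j)%N - c k.
  elim: j => [|j IH]; first by rewrite addn0 !subrr nrm0.
  rewrite addnS -(subrKA (u (k + j)%N)) -(subrKA (c (k + j)%N)).
  by rewrite (le_trans (nrmD _ _)) // lerD.
have ucL k j : nrm (u (k + j)%N - u k) <= L - c k.
  by rewrite (le_trans (ucD _ _)) // lerD2r.
have : cvg (u @ \oo).
  apply: Vc; apply/cauchyP => _ /= /gt0_complex[d d0 ->].
  have [k Lck] := cL _ (divr_gt0 d0 (ltr0n _ 2)).
  exists (u k); exists k => // j /= kj.
  rewrite -ball_normE /= nrm_ltP nrmB -(subnKC kj).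
  rewrite (le_lt_trans (ucL _ _)) // (le_lt_trans Lck) //.
  by rewrite ltr_pdivrMr // mulr2n mulrDr mulr1 ltrDl.
move=> /cvg_ex[l /cvgrPdist_lt ul]; exists l => k.
apply/ler_addgt0Pr => e e0.
have [N _ /(_ (k + N)%N (leq_addl _ _)) /=] := ul e%:C%C ltac:(by rewrite ltcR).
rewrite nrm_ltP => lN.
rewrite -(subrKA (u (k + N)%N)) (le_trans (nrmD _ _)) //.
by rewrite addrC lerD // ltW.
Qed.

End NormedBasics.

Section PrecategoryBasics.
Variables (R : realType) (H : nat -> nat -> normedModType R[i]).
Variables (T : cstar_precat H).
Local Notation "a ** b" := (hcomp T a b) (at level 40, left associativity).
Local Notation "a ^s" := (hstar T a) (at level 2, format "a ^s").

Lemma hcompDl n m l (a a' : H n m) (b : H m l) : (a + a') ** b = a ** b + a' ** b.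
Proof. by have := hcomp_linearl T 1 a a' b; rewrite !scale1r. Qed.
Lemma hcompDr n m l (a : H n m) (b b' : H m l) : a ** (b + b') = a ** b + a ** b'.
Proof. by have := hcomp_linearr T 1 a b b'; rewrite !scale1r. Qed.
Lemma hcomp0l n m l (b : H m l) : (0 : H n m) ** b = 0.
Proof. by apply: (addrI (0 ** b)); rewrite -hcompDl !addr0. Qed.
Lemma hcomp0r n m l (a : H n m) : a ** (0 : H m l) = 0.
Proof. by apply: (addrI (a ** 0)); rewrite -hcompDr !addr0. Qed.
Lemma hcompZl n m l c (a : H n m) (b : H m l) : (c *: a) ** b = c *: (a ** b).
Proof. by have := hcomp_linearl T c a 0 b; rewrite !addr0 hcomp0l addr0. Qed.
Lemma hcompZr n m l c (a : H n m) (b : H m l) : a ** (c *: b) = c *: (a ** b).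
Proof. by have := hcomp_linearr T c a b 0; rewrite !addr0 hcomp0r addr0. Qed.
Lemma hcompNl n m l (a : H n m) (b : H m l) : (- a) ** b = - (a ** b).
Proof. by rewrite -scaleN1r hcompZl scaleN1r. Qed.
Lemma hcompNr n m l (a : H n m) (b : H m l) : a ** (- b) = - (a ** b).
Proof. by rewrite -scaleN1r hcompZr scaleN1r. Qed.
Lemma hcompBl n m l (a a' : H n m) (b : H m l) : (a - a') ** b = a ** b - a' ** b.
Proof. by rewrite hcompDl hcompNl. Qed.
Lemma hcompBr n m l (a : H n m) (b b' : H m l) : a ** (b - b') = a ** b - a ** b'.
Proof. by rewrite hcompDr hcompNr. Qed.

Lemma hstarD n m (a b : H n m) : (a + b)^s = a^s + b^s.
Proof. by have := hstar_antilinear T 1 a b; rewrite conjC1 !scale1r. Qed.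
Lemma hstar0 n m : (0 : H n m)^s = 0.
Proof. by apply: (addrI (0^s)); rewrite -hstarD !addr0. Qed.
Lemma hstarZ n m c (a : H n m) : (c *: a)^s = c^* *: a^s.
Proof. by have := hstar_antilinear T c a 0; rewrite !addr0 hstar0 addr0. Qed.
Lemma hstarN n m (a : H n m) : (- a)^s = - a^s.
Proof. by apply: (addrI (a^s)); rewrite -hstarD !subrr hstar0. Qed.
Lemma hstarB n m (a b : H n m) : (a - b)^s = a^s - b^s.
Proof. by rewrite hstarD hstarN. Qed.

Lemma nrm_hcomp n m l (a : H n m) (b : H m l) : nrm (a ** b) <= nrm a * nrm b.
Proof. by rewrite -lecR rmorphM /= -!nrmE hcomp_norm. Qed.

Lemma nrm_cstar n m (a : H n m) : nrm (a^s ** a) = nrm a ^+ 2.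
Proof. by apply: complexI; rewrite rmorphXn /= -!nrmE cstar_identity. Qed.

(** Cancel [||a||] in [||a||^2 = ||a^s a|| <= ||a^s|| ||a||]. *)
Lemma nrm_hstar_le n m (a : H n m) : nrm a <= nrm a^s.
Proof.
have [a0|a0] := leP (nrm a) 0; first by rewrite (le_trans a0) ?nrm_ge0.
by have := nrm_hcomp a^s a; rewrite nrm_cstar expr2 ler_pM2r.
Qed.

Lemma nrm_hstar n m (a : H n m) : nrm a^s = nrm a.
Proof.
by apply: le_anti; rewrite nrm_hstar_le -{2}(hstarK T a) nrm_hstar_le.
Qed.

Lemma nrm_cstarr n m (a : H n m) : nrm (a ** a^s) = nrm a ^+ 2.
Proof. by rewrite -{1}(hstarK T a) nrm_cstar nrm_hstar. Qed.

End PrecategoryBasics.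

(** * Unitization of T(m,m) *)

Section Unitization.
Variables (R : realType) (H : nat -> nat -> normedModType R[i]).
Variables (T : cstar_precat H) (m : nat).
Local Notation "a ** b" := (hcomp T a b) (at level 40, left associativity).
Local Notation "a ^s" := (hstar T a) (at level 2, format "a ^s").

(** A pair [(x, c)] stands for [x + c 1], as [T(m,m)] may lack a unit. The precategory indexes the
    type so that the ring structure can depend on its composition. *)
Definition unitization of cstar_precat H := (H m m * R[i]^o)%type.
Local Notation A := (unitization T).

HB.instance Definition _ := GRing.Lmodule.on A.

Definition unitz_one : A := (0, 1).
Definition unitz_mul (u v : A) : A :=
  (u.1 ** v.1 + u.2 *: v.1 + v.2 *: u.1, u.2 * v.2).

Fact unitz_mulA : associative unitz_mul.
Proof.
move=> u v w; congr (_, _); rewrite /= ?mulrA //.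
rewrite !(hcompDl, hcompDr, hcompZl, hcompZr, scalerDr, scalerA, hcompA) /=.
rewrite -!addrA; congr (_ + _).
rewrite [w.2 * v.2]mulrC [w.2 * u.2]mulrC [RHS]addrCA; congr (_ + _).
by rewrite addrCA; congr (_ + _); rewrite addrCA.
Qed.
Fact unitz_mul1 : left_id unitz_one unitz_mul.
Proof.
move=> [x c]; congr (_, _); rewrite /= ?mul1r //.
by rewrite hcomp0l add0r scale1r scaler0 addr0.
Qed.
Fact unitz_mulr1 : right_id unitz_one unitz_mul.
Proof.
move=> [x c]; congr (_, _); rewrite /= ?mulr1 //.
by rewrite hcomp0r add0r scale1r scaler0 add0r.
Qed.
Fact unitz_mulDl : left_distributive unitz_mul +%R.
Proof.
move=> u v w; congr (_, _); rewrite /= ?mulrDl //.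
by rewrite hcompDl scalerDl scalerDr [RHS]addrACA; congr (_ + _); exact: addrACA.
Qed.
Fact unitz_mulDr : right_distributive unitz_mul +%R.
Proof.
move=> u v w; congr (_, _); rewrite /= ?mulrDr //.
by rewrite hcompDr scalerDl scalerDr [RHS]addrACA; congr (_ + _); exact: addrACA.
Qed.
Fact unitz_one_neq0 : unitz_one != 0.
Proof. by apply/eqP => -[] /eqP; rewrite oner_eq0. Qed.

HB.instance Definition _ := GRing.Zmodule_isNzRing.Build A
  unitz_mulA unitz_mul1 unitz_mulr1 unitz_mulDl unitz_mulDr unitz_one_neq0.

Fact unitz_scaleAl c (u v : A) : c *: (u * v) = c *: u * v.
Proof.
congr (_, _); last exact: mulrA.
rewrite hcompZl !scalerDr !scalerA /=.
by rewrite [v.2 * c]mulrC.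
Qed.
HB.instance Definition _ := GRing.Lmodule_isLalgebra.Build R[i] A unitz_scaleAl.
Fact unitz_scaleAr c (u v : A) : c *: (u * v) = u * (c *: v).
Proof.
congr (_, _); last exact: mulrCA.
rewrite hcompZr !scalerDr !scalerA /=.
by rewrite [u.2 * c]mulrC.
Qed.
HB.instance Definition _ := GRing.Lalgebra_isAlgebra.Build R[i] A unitz_scaleAr.

Definition unitz_in (x : H m m) : A := (x, 0).
Definition unitz_star (u : A) : A := (u.1^s, u.2^*).
Definition lact l (u : A) (b : H m l) : H m l := u.1 ** b + u.2 *: b.
Definition ract n (x : H n m) (u : A) : H n m := x ** u.1 + u.2 *: x.

Lemma lactDl l (u v : A) (b : H m l) : lact (u + v) b = lact u b + lact v b.
Proof. by rewrite /lact hcompDl scalerDl addrACA. Qed.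
Lemma lactZl l c (u : A) (b : H m l) : lact (c *: u) b = c *: lact u b.
Proof. by rewrite /lact hcompZl scalerDr scalerA. Qed.
Lemma lactNl l (u : A) (b : H m l) : lact (- u) b = - lact u b.
Proof. by rewrite -scaleN1r lactZl scaleN1r. Qed.
Lemma lactM l (u v : A) (b : H m l) : lact (u * v) b = lact u (lact v b).
Proof.
rewrite /lact /= !(hcompDl, hcompDr, hcompZl, hcompZr, scalerDr, scalerA, hcompA).
by rewrite -!addrA; congr (_ + _); rewrite addrCA.
Qed.
Lemma lact1 l (b : H m l) : lact (1 : A) b = b.
Proof. by rewrite /lact /= hcomp0l add0r scale1r. Qed.
Lemma lact_in l x (b : H m l) : lact (unitz_in x) b = x ** b.
Proof. by rewrite /lact /= scale0r addr0. Qed.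

Lemma ractDl n (x y : H n m) (u : A) : ract (x + y) u = ract x u + ract y u.
Proof. by rewrite /ract hcompDl scalerDr addrACA. Qed.
Lemma ractNl n (x : H n m) (u : A) : ract (- x) u = - ract x u.
Proof. by rewrite /ract hcompNl scalerN opprD. Qed.
Lemma ractDr n (x : H n m) (u v : A) : ract x (u + v) = ract x u + ract x v.
Proof. by rewrite /ract hcompDr scalerDl addrACA. Qed.
Lemma ractZr n c (x : H n m) (u : A) : ract x (c *: u) = c *: ract x u.
Proof. by rewrite /ract hcompZr scalerDr scalerA. Qed.
Lemma ractNr n (x : H n m) (u : A) : ract x (- u) = - ract x u.
Proof. by rewrite -scaleN1r ractZr scaleN1r. Qed.
Lemma ractM n (x : H n m) (u v : A) : ract x (u * v) = ract (ract x u) v.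
Proof.
rewrite /ract /= !(hcompDl, hcompDr, hcompZl, hcompZr, scalerDr, scalerA, hcompA).
rewrite -!addrA; congr (_ + _); rewrite [v.2 * u.2]mulrC.
by rewrite addrCA addrA.
Qed.
Lemma ract1 n (x : H n m) : ract x (1 : A) = x.
Proof. by rewrite /ract /= hcomp0r add0r scale1r. Qed.
Lemma ract_in n (x : H n m) y : ract x (unitz_in y) = x ** y.
Proof. by rewrite /ract /= scale0r addr0. Qed.

Lemma hcomp_ract n l (x : H n m) (u : A) (b : H m l) : ract x u ** b = x ** lact u b.
Proof. by rewrite /ract /lact hcompDl hcompDr hcompZl hcompZr hcompA. Qed.
Lemma lact_hcomp n l (u : A) (b : H m l) (d : H l n) : lact u b ** d = lact u (b ** d).
Proof. by rewrite /lact hcompDl hcompZl hcompA. Qed.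
Lemma hcomp_ractr n l (y : H l n) (x : H n m) (u : A) : y ** ract x u = ract (y ** x) u.
Proof. by rewrite /ract hcompDr hcompZr hcompA. Qed.

Lemma unitz_starD (u v : A) : unitz_star (u + v) = unitz_star u + unitz_star v.
Proof. by congr (_, _); [exact: hstarD | exact: rmorphD]. Qed.
Lemma unitz_starZ c (u : A) : unitz_star (c *: u) = c^* *: unitz_star u.
Proof. by congr (_, _); [exact: hstarZ | exact: rmorphM]. Qed.
Lemma unitz_starN (u : A) : unitz_star (- u) = - unitz_star u.
Proof. by congr (_, _); [exact: hstarN | exact: rmorphN]. Qed.
Lemma unitz_starM (u v : A) : unitz_star (u * v) = unitz_star v * unitz_star u.
Proof.
congr (_, _); rewrite /= ?rmorphM 1?mulrC //.
by rewrite !hstarD !hstarZ hstar_comp -!addrA; congr (_ + _); rewrite addrC.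
Qed.
Lemma unitz_star1 : unitz_star (1 : A) = 1.
Proof. by congr (_, _); [exact: hstar0 | exact: conjC1]. Qed.
Lemma unitz_starK : involutive unitz_star.
Proof. by move=> [x c]; congr (_, _); [exact: hstarK | exact: conjCK]. Qed.
Lemma unitz_starX (u : A) k : unitz_star (u ^+ k) = unitz_star u ^+ k.
Proof.
by elim: k => [|k IH]; [exact: unitz_star1 | rewrite exprSr unitz_starM IH exprS].
Qed.
Lemma unitz_star_in (x : H m m) : unitz_star (unitz_in x) = unitz_in x^s.
Proof. by congr (_, _); exact: conjC0. Qed.
Lemma unitz_inM (x y : H m m) : unitz_in (x ** y) = unitz_in x * unitz_in y.
Proof. by congr (_, _); rewrite /= ?mul0r // !scale0r !addr0. Qed.
Lemma unitz_inD (x y : H m m) : unitz_in (x + y) = unitz_in x + unitz_in y.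
Proof. by congr (_, _); rewrite /= addr0. Qed.
Lemma unitz_inZ c (x : H m m) : unitz_in (c *: x) = c *: unitz_in x.
Proof. by congr (_, _); rewrite /= scaler0. Qed.

Lemma hstar_lact l (u : A) (b : H m l) : (lact u b)^s = ract b^s (unitz_star u).
Proof. by rewrite /lact /ract hstarD hstarZ hstar_comp. Qed.
Lemma hstar_ract n (x : H n m) (u : A) : (ract x u)^s = lact (unitz_star u) x^s.
Proof. by rewrite /lact /ract hstarD hstarZ hstar_comp. Qed.

Implicit Types c d : R.

(** Bounds for left multiplication on all [T(m,l)] at once take the place of a norm on the
    unitization. *)
Definition opbound (u : A) (c : R) :=
  forall l (b : H m l), nrm (lact u b) <= c * nrm b.

Lemma opboundW u c d : opbound u c -> c <= d -> opbound u d.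
Proof.
by move=> uc cd l b; rewrite (le_trans (uc _ _)) // ler_wpM2r ?nrm_ge0.
Qed.
Lemma opboundD u v c d : opbound u c -> opbound v d -> opbound (u + v) (c + d).
Proof.
move=> uc vd l b; rewrite lactDl (le_trans (nrmD _ _)) // mulrDl.
by rewrite lerD ?uc ?vd.
Qed.
Lemma opboundZ u c (k : R[i]) : opbound u c -> opbound (k *: u) (complex.Re `|k| * c).
Proof.
move=> uc l b; rewrite lactZl nrmZ -mulrA ler_wpM2l //.
exact: (nrm_ge0 (k : R[i]^o)).
Qed.
Lemma opboundZR u c (k : R) : 0 <= k -> opbound u c -> opbound (k%:C%C *: u) (k * c).
Proof. by move=> k0 /(opboundZ k%:C%C); rewrite ger0_norm ?lecR. Qed.
Lemma opboundN u c : opbound u c -> opbound (- u) c.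
Proof. by move=> uc l b; rewrite lactNl nrmN. Qed.
Lemma opboundB u v c d : opbound u c -> opbound v d -> opbound (u - v) (c + d).
Proof. by move=> uc /opboundN; exact: opboundD. Qed.
Lemma opboundM u v c d : 0 <= c -> opbound u c -> opbound v d -> opbound (u * v) (c * d).
Proof.
move=> c0 uc vd l b; rewrite lactM (le_trans (uc _ _)) // -mulrA ler_wpM2l //.
Qed.
Lemma opbound1 : opbound 1 1.
Proof. by move=> l b; rewrite lact1 mul1r. Qed.
Lemma opbound0 : opbound 0 0.
Proof. by move=> l b; rewrite /lact hcomp0l scale0r addr0 nrm0 mul0r. Qed.
Lemma opboundX u c k : 0 <= c -> opbound u c -> opbound (u ^+ k) (c ^+ k).
Proof.
move=> c0 uc; elim: k => [|k IH]; first exact: opbound1.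
by rewrite !exprS; apply: opboundM.
Qed.

(** [||u b||^2 = ||b^s (u^s u b)|| <= ||b|| c^2 ||b||]. *)
Lemma opbound_cstar u c : 0 <= c -> opbound (unitz_star u * u) (c ^+ 2) -> opbound u c.
Proof.
move=> c0 uuc l b.
rewrite -(@ler_pXn2r _ 2) ?nnegrE ?mulr_ge0 ?nrm_ge0 // -(nrm_cstar T).
rewrite hstar_lact hcomp_ract -lactM (le_trans (nrm_hcomp _ _ _)) //.
rewrite nrm_hstar exprMn [_ ^+ 2 * nrm b ^+ 2]mulrC expr2 -mulrA ler_wpM2l ?nrm_ge0 //.
by rewrite mulrC uuc.
Qed.

(** [||u^s b||^2 = ||b^s (u u^s b)|| <= ||b|| c ||u^s b||], and one factor cancels. *)
Lemma opbound_star u c : 0 <= c -> opbound u c -> opbound (unitz_star u) c.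
Proof.
move=> c0 uc l b.
have [b0|b0] := leP (nrm (lact (unitz_star u) b)) 0.
  by rewrite (le_trans b0) // mulr_ge0 // nrm_ge0.
rewrite -(ler_pM2r b0) -expr2 -(nrm_cstar T).
rewrite hstar_lact unitz_starK hcomp_ract (le_trans (nrm_hcomp _ _ _)) //.
by rewrite nrm_hstar [c * _]mulrC -mulrA ler_wpM2l ?nrm_ge0 // uc.
Qed.

(** The involution turns right multiplication by [u] into left multiplication by [unitz_star u], so
    left bounds suffice. *)
Lemma nrm_ract n (x : H n m) (u : A) c : 0 <= c -> opbound u c ->
  nrm (ract x u) <= nrm x * c.
Proof.
move=> c0 uc; rewrite -(nrm_hstar T) hstar_ract mulrC -(nrm_hstar T x).
by apply: opbound_star.
Qed.

Lemma unitz_in_ract (x : H m m) (u : A) : unitz_in x * u = unitz_in (ract x u).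
Proof. by congr (_, _); rewrite /= ?mul0r // scale0r addr0. Qed.

(** Testing the bound on [x^s] gives [||x||^2 <= c ||x||]. *)
Lemma nrm_le_opbound (x : H m m) c : 0 <= c -> opbound (unitz_in x) c -> nrm x <= c.
Proof.
move=> c0 /(_ m x^s); rewrite lact_in nrm_cstarr nrm_hstar expr2 => xc.
have [x0|x0] := leP (nrm x) 0; first exact: le_trans c0.
by rewrite -(ler_pM2r x0).
Qed.

(* p + i q is normal, has squared modulus p^2 + q^2, and p is its real part. *)
Lemma opbound_sqrD p q c : 0 <= c -> unitz_star p = p -> unitz_star q = q ->
  p * q = q * p -> opbound (p ^+ 2 + q ^+ 2) (c ^+ 2) -> opbound p c.
Proof.
move=> c0 ps qs pq pqc; pose u := p + 'i *: q.
have us : unitz_star u = p - 'i *: q.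
  by rewrite unitz_starD unitz_starZ ps qs conjCi scaleNr.
have uc : opbound u c.
  apply: opbound_cstar => //; rewrite us mulrBl !mulrDr.
  rewrite -!scalerAl -!scalerAr scalerA -[_ * _ in X in _ - (_ + X)]expr2 sqrCi scaleN1r opprD opprK.
  by rewrite pq addrA addrK -!expr2.
have := opboundZR (divr_ge0 (ler0n R 1) (ler0n R 2))
  (opboundD uc (opbound_star c0 uc)).
suff -> : (1 / 2)%:C%C *: (u + unitz_star u) = p.
  by have -> : 1 / 2 * (c + c) = c by field.
have -> : u + unitz_star u = 2%:R *: p.
  by rewrite us addrACA subrr addr0 scaler_nat mulr2n.
rewrite scalerA -[RHS]scale1r; congr (_ *: _).
by rewrite -(rmorph_nat (real_complex R)) -rmorphM divfK ?pnatr_eq0.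
Qed.

End Unitization.

(** * Self-adjoint elements *)

Section SelfAdjointCalculus.
Variables (R : realType) (H : nat -> nat -> normedModType R[i]).
Variables (T : cstar_precat H).
Local Notation "a ** b" := (hcomp T a b) (at level 40, left associativity).
Local Notation "a ^s" := (hstar T a) (at level 2, format "a ^s").

Lemma half_complex : (2^-1 : R)%:C%C * 2%:R = 1 :> R[i].
Proof. by rewrite -(rmorph_nat (real_complex R)) -rmorphM mulVf ?pnatr_eq0. Qed.

Lemma conjC_RtoC (c : R) : (c%:C%C)^* = c%:C%C.
Proof. by apply: conj_Creal; rewrite realE !lecR le_total. Qed.

(** Rearrangement showing that the limit [l] of the square root iteration is a fixed point: [v] is
    the next iterate, [x] is [h^2], and [y], [w] are the squares of the current iterate and of
    [l]. *)
Lemma double_sub (V : zmodType) (l v w x y : V) : v + v = x + y ->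
  l + l - (x + w) = l - v + (l - v) - (w - y).
Proof.
move=> vE; have -> : x = v + v - y by rewrite vE addrK.
rewrite !opprD !opprK !addrA [RHS]addrAC; congr (_ + _ + _).
by rewrite -!addrA; congr (_ + _); rewrite addrCA.
Qed.

(* 1 - s is the square root of 1 - h^2: s is the limit of the iteration
   u |-> (h^2 + u^2)/2, dominated by its scalar version t |-> (1 + t^2)/2. *)
Lemma selfadjoint_sqrt m (h : H m m) : h^s = h -> nrm h <= 1 ->
  exists s, [/\ s^s = s, h ** s = s ** h & s + s = h ** h + s ** s].
Proof.
move=> hs h1; pose half (x : H m m) := (2^-1 : R)%:C%C *: x.
have halfD x : half x + half x = x.
  by rewrite -mulr2n -scaler_nat scalerA mulrC half_complex scale1r.
have nrm_half x : nrm (half x) = 2^-1 * nrm x by rewrite nrmZR ?invr_ge0.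
have [u [u0 uS]] : exists u, u 0%N = 0 /\ forall k, u k.+1 = half (h ** h + u k ** u k).
  by exists (fun k => iter k (fun x => half (h ** h + x ** x)) 0).
have [c [c0 cS]] : exists c : nat -> R, c 0%N = 0 /\ forall k, c k.+1 = 2^-1 * (1 + c k ^+ 2).
  by exists (fun k => iter k (fun t : R => 2^-1 * (1 + t ^+ 2)) 0).
have h2 : nrm (h ** h) <= 1.
  by rewrite (le_trans (nrm_hcomp _ _ _)) // mulr_ile1 ?nrm_ge0.
(* In terms of [d = 1 - c k] the recursion is [d - d^2 / 2], which decays like [2 / (k + 2)]; the
   second conjunct records this rate. *)
have c01 k : 0 <= c k <= 1 /\ (1 - c k) * k.+2%:R <= 2.
  elim: k => [|k [/andP[IH0 IH1] IH2]]; first by rewrite c0 lexx ler01 subr0 mul1r.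
  rewrite cS; set t := c k in IH0 IH1 IH2 *.
  rewrite -[k.+3]addn1 natrD; set n := k.+2%:R in IH2 *.
  split; [apply/andP; split; nra|].
  have n0 : 0 <= n by rewrite /n.
  nra.
have uc k : nrm (u k) <= c k.
  elim: k => [|k IH]; first by rewrite u0 c0 nrm0.
  rewrite uS cS nrm_half ler_wpM2l ?invr_ge0 // (le_trans (nrmD _ _)) //.
  rewrite lerD // (le_trans (nrm_hcomp _ _ _)) // expr2.
  by rewrite ler_pM ?nrm_ge0.
have uu k : nrm (u k.+1 - u k) <= c k.+1 - c k.
  elim: k => [|k IH].
    rewrite uS cS u0 c0 !subr0 nrm_half hcomp0l expr0n /= !addr0.
    by rewrite ler_wpM2l ?invr_ge0.
  rewrite (uS k.+1) [X in _ - X](uS k) (cS k.+1) [X in _ <= _ - X](cS k).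
  rewrite -scalerBr -mulrBr nrm_half ler_wpM2l ?invr_ge0 //.
  rewrite !opprD !(addrACA _ _ (- _)) !subrr !add0r.
  rewrite -(subrKA (u k.+1 ** u k)) -hcompBr -hcompBl.
  rewrite (le_trans (nrmD _ _)) // subr_sqr mulrDr mulrC.
  have := uc k; have := uc k.+1 => uk1 uk.
  rewrite lerD // (le_trans (nrm_hcomp _ _ _)) //.
    by rewrite ler_pM ?nrm_ge0.
  by rewrite ler_pM ?nrm_ge0.
have cL e : 0 < e -> exists k, 1 - c k <= e.
  move=> e0; exists (Num.bound (2 / e)); set k := Num.bound _.
  have ke : 2 < k%:R * e by rewrite -ltr_pdivrMr // archi_boundP ?divr_ge0 ?ltW.
  have [_] := c01 k; rewrite -addn2 natrD.
  have : 0 <= k%:R :> R by []; move: (k%:R) ke => r ke r0.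
  nra.
have [l ul] : exists l, forall k, nrm (l - u k) <= 1 - c k.
  apply: dominated_increments_cvg => //; first exact: (homs_complete T).
  by move=> k; have [/andP[]] := c01 k.
(* Each required equation thus follows from an error bound by a fixed multiple of [1 - c k]. *)
have nul n (x : H n n) (K : R) : 0 <= K -> (forall k, nrm x <= K * (1 - c k)) -> x = 0.
  move=> K0 xK; apply: nrm_le0; apply/ler_addgt0Pr => e e0; rewrite add0r.
  have K1 : 0 < K + 1 by rewrite ltr_wpDl.
  have [k ck] := cL _ (divr_gt0 e0 K1); rewrite (le_trans (xK k)) //.
  rewrite (le_trans (ler_wpM2l K0 ck)) // mulrCA ler_piMr ?ltW //.
  by rewrite ltr_pdivrMr // mul1r ltrDl.
have l1 : nrm l <= 1 by have := ul 0%N; rewrite u0 c0 !subr0.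
have us k : (u k)^s = u k.
  elim: k => [|k IH]; first by rewrite u0 hstar0.
  rewrite uS /half hstarZ conjC_RtoC hstarD !hstar_comp hs IH //.
have uh k : h ** u k = u k ** h.
  elim: k => [|k IH]; first by rewrite u0 hcomp0l hcomp0r.
  rewrite uS /half hcompZr hcompZl hcompDr hcompDl !hcompA.
  by rewrite IH -(hcompA _ (u k)) IH hcompA.
exists l; split; apply/eqP; rewrite -subr_eq0; apply/eqP.
- apply: (nul _ _ 2) => // k.
  rewrite -(subrKA (u k)) -{1}(us k) -hstarB (le_trans (nrmD _ _)) //.
  by have := ul k; rewrite nrm_hstar (nrmB (u k)); lra.
- apply: (nul _ _ 2) => // k.
  rewrite -(subrKA (h ** u k)) {2}uh -hcompBr -hcompBl (le_trans (nrmD _ _)) //.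
  rewrite mulr_natl mulr2n lerD // (le_trans (nrm_hcomp _ _ _)) //.
    by rewrite (le_trans _ (ul k)) // ler_piMl ?nrm_ge0.
  by rewrite nrmB (le_trans _ (ul k)) // ler_piMr ?nrm_ge0.
- apply: (nul _ _ 4) => // k.
  have -> : l + l - (h ** h + l ** l) =
    (l - u k.+1) + (l - u k.+1) - ((l - u k) ** l + u k ** (l - u k)).
    have -> : (l - u k) ** l + u k ** (l - u k) = l ** l - u k ** u k.
      by rewrite hcompBl hcompBr addrA subrK.
    by apply: double_sub; rewrite uS halfD.
  rewrite (le_trans (nrmD _ _)) // nrmN.
  have A := le_trans (nrmD (l - u k.+1) (l - u k.+1)) (lerD (ul _) (ul _)).
  have B := le_trans (nrmD ((l - u k) ** l) _) (lerD (nrm_hcomp T _ _) (nrm_hcomp T (u k) (l - u k))).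
  have [/andP[ck0 ck1] _] := c01 k.
  have B1 : nrm (l - u k) * nrm l <= (1 - c k) * 1 by apply: ler_pM; rewrite ?nrm_ge0.
  have B2 : nrm (u k) * nrm (l - u k) <= 1 * (1 - c k).
    by apply: ler_pM; rewrite ?nrm_ge0 ?(le_trans (uc k)).
  by rewrite cS in A; nra.
Qed.

(** With [q = 1 - s] the hypothesis on [s] reads [h^2 + q^2 = 1], so [opbound_sqrD] bounds both [h]
    and [q], and [1 - h^2 = q^2]. The hypotheses are equations only, hence survive tensoring. *)
Lemma circle_opbound m (h s : H m m) : h^s = h -> s^s = s -> h ** s = s ** h ->
    s + s = h ** h + s ** s ->
  opbound (unitz_in T h) 1 /\ opbound (1 - unitz_in T h ^+ 2) 1.
Proof.
move=> hs ss hsC sE; pose p := unitz_in T h; pose q := 1 - unitz_in T s.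
have ps : unitz_star p = p by rewrite unitz_star_in hs.
have qs : unitz_star q = q by rewrite unitz_starD unitz_starN unitz_star1 unitz_star_in ss.
have pq : p * q = q * p by rewrite mulrBr mulrBl mulr1 mul1r -!unitz_inM hsC.
have qE : q ^+ 2 = 1 - p ^+ 2.
  have SE : unitz_in T s + unitz_in T s = p * p + unitz_in T s * unitz_in T s.
    by rewrite -!unitz_inM -!unitz_inD sE.
  rewrite /q !expr2 mulrBl mul1r mulrBr mulr1 opprB addrCA addrC.
  by rewrite -[1 - _ - _]addrA -opprD SE opprD addrA subrK.
have one : opbound (1 : unitization m T) (1 ^+ 2) by rewrite expr1n; exact: opbound1.
split.
  by apply: (opbound_sqrD _ ps qs pq); rewrite ?ler01 // qE addrC subrK.
rewrite -qE -(expr1n _ 2); apply: opboundX => //.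
by apply: (opbound_sqrD _ qs ps (esym pq)); rewrite ?ler01 // qE subrK.
Qed.

(** Rescaling to the unit ball. The bound stands in for the spectrum of [h^2] lying in
    [[0, M^2]]. *)
Lemma opbound_one_sub_sqr m (h : H m m) (M : R) : 0 < M -> h^s = h -> nrm h <= M ->
  opbound ((M ^+ 2)%:C%C%:A - unitz_in T h ^+ 2) (M ^+ 2).
Proof.
move=> M0 hs hM; have M0' : 0 <= M^-1 by rewrite invr_ge0 ltW.
pose g := (M^-1)%:C%C *: h.
have gs : g^s = g by rewrite hstarZ conjC_RtoC hs.
have g1 : nrm g <= 1 by rewrite nrmZR // mulrC ler_pdivrMr // mul1r.
have [s [ss sC sE]] := selfadjoint_sqrt gs g1.
have [_ /(opboundZR (sqr_ge0 M))] := circle_opbound gs ss sC sE.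
rewrite mulr1 scalerBr unitz_inZ exprZn scalerA -rmorphXn -rmorphM.
by rewrite -exprMn mulfV ?expr1n ?scale1r // gt_eqF.
Qed.

Section Contractive.
Variable t : right_tensoring T.

(** After normalising to [||g|| = 1], the equations relating [g^s g] to its companion [s] are
    preserved by tensoring, so [circle_opbound] bounds the image of [g^s g] by 1; the C*-identity
    concludes. *)
Lemma tens_contractive n m (a : H n m) : nrm (tens t n m a) <= nrm a.
Proof.
have [/nrm_le0 ->|a0] := leP (nrm a) 0; first by rewrite raddf0 !nrm0.
have a0' : 0 <= (nrm a)^-1 by rewrite invr_ge0 ltW.
pose g := ((nrm a)^-1)%:C%C *: a; pose h := g^s ** g.
have g1 : nrm g = 1 by rewrite nrmZR // mulVf // gt_eqF.
have hs : h^s = h by rewrite hstar_comp hstarK.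
have h1 : nrm h <= 1 by rewrite nrm_cstar g1 expr1n.
have [s [ss sC sE]] := selfadjoint_sqrt hs h1.
case: (@circle_opbound _ (tens t _ _ h) (tens t _ _ s)).
- by rewrite -tens_hstar hs.
- by rewrite -tens_hstar ss.
- by rewrite -!tens_hcomp sC.
- by rewrite -!tens_hcomp -!raddfD sE.
move=> /(nrm_le_opbound ler01) + _; rewrite tens_hcomp tens_hstar nrm_cstar expr_le1 ?nrm_ge0 //.
by rewrite linearZ nrmZR // mulrC ler_pdivrMr // mul1r.
Qed.

End Contractive.
End SelfAdjointCalculus.

(** * Truncated resolvents and approximate units *)

Section Damping.
Variables (R : realType) (H : nat -> nat -> normedModType R[i]).
Variables (T : cstar_precat H).
Local Notation "a ** b" := (hcomp T a b) (at level 40, left associativity).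
Local Notation "a ^s" := (hstar T a) (at level 2, format "a ^s").
Implicit Types (c M e : R) (n : nat).

(* Partial sum of the Neumann series of (1 + c v^2)^-1, expanded around
   1 + c M^2. *)
Definition damping_ratio m c M (v : unitization m T) : unitization m T :=
  (c / (1 + c * M ^+ 2))%:C%C *: ((M ^+ 2)%:C%C%:A - v ^+ 2).
Definition damping m c M n (v : unitization m T) : unitization m T :=
  ((1 + c * M ^+ 2)^-1)%:C%C *: \sum_(j < n) damping_ratio c M v ^+ j.

(** With [k = 1 + c M^2] and [y] the ratio, [1 + c v^2 = k (1 - y)], and the geometric sum
    telescopes. The truncation error is therefore exactly [y^n]. *)
Lemma damping_resolvent m c M n (v : unitization m T) : 0 < 1 + c * M ^+ 2 ->
  (1 + c%:C%C *: v ^+ 2) * damping c M n v = 1 - damping_ratio c M v ^+ n.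
Proof.
move=> k0; set y := damping_ratio c M v; set k := 1 + c * M ^+ 2 in k0 *.
have kK : (k^-1)%:C%C * k%:C%C = 1 :> R[i] by rewrite -rmorphM mulVf // gt_eqF.
have -> : 1 + c%:C%C *: v ^+ 2 = k%:C%C *: (1 - y).
  rewrite scalerBr /y /damping_ratio -/k scalerA -rmorphM mulrCA mulfV ?gt_eqF // mulr1.
  rewrite scalerBr scalerA -rmorphM opprB addrCA -scalerBl -rmorphB /k.
  by rewrite addrK scale1r addrC.
rewrite /damping -/k -scalerAl -scalerAr scalerA mulrC kK scale1r -/y.
by rewrite -[LHS]opprK -mulNr opprB -subrX1 opprB.
Qed.

Lemma comm_scaler (A : algType R[i]) (x y : A) (k : R[i]) :
  GRing.comm x y -> GRing.comm x (k *: y).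
Proof. by move=> xy; rewrite /GRing.comm -scalerAl -scalerAr xy. Qed.

Lemma damping_comm m c M n (v : unitization m T) : GRing.comm v (damping c M n v).
Proof.
apply: comm_scaler; apply: commr_sum => j _; apply: commrX; apply: comm_scaler.
by apply: commrB; [apply: comm_scaler; exact: commr1 | exact: commrX].
Qed.

Lemma damping_star m c M n (v : unitization m T) : unitz_star v = v ->
  unitz_star (damping c M n v) = damping c M n v.
Proof.
move=> vs; have ys : unitz_star (damping_ratio c M v) = damping_ratio c M v.
  by rewrite unitz_starZ unitz_starD unitz_starN unitz_starX unitz_starZ unitz_star1
    vs !conjC_RtoC.
rewrite unitz_starZ conjC_RtoC; congr (_ *: _).
elim: n => [|n IH]; first by rewrite !big_ord0 -(scale0r 1) unitz_starZ conjC0 !scale0r.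
by rewrite !big_ord_recr /= unitz_starD IH unitz_starX ys.
Qed.

Lemma damping_ratio_opbound m c M (h : H m m) : 0 < c -> 0 < M -> h^s = h ->
  nrm h <= M ->
  opbound (damping_ratio c M (unitz_in T h)) (c * M ^+ 2 / (1 + c * M ^+ 2)).
Proof.
move=> c0 M0 hs hM; have k0 : 0 < 1 + c * M ^+ 2.
  by rewrite addr_gt0 // mulr_gt0 // exprn_gt0.
have := opboundZR (ltW (divr_gt0 c0 k0)) (opbound_one_sub_sqr M0 hs hM).
by rewrite mulrAC.
Qed.

(** The ratio is bounded by [th = c M^2 / k] with [k (1 - th) = 1], so the geometric series, divided
    by [k], stays below 1 for every [n]. *)
Lemma damping_opbound m c M n (h : H m m) : 0 < c -> 0 < M -> h^s = h ->
  nrm h <= M -> opbound (damping c M n (unitz_in T h)) 1.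
Proof.
move=> c0 M0 hs hM; have := damping_ratio_opbound c0 M0 hs hM.
set k := 1 + c * M ^+ 2; set th := _ / k; set y := damping_ratio _ _ _ => yth.
have k0 : 0 < k by rewrite /k addr_gt0 // mulr_gt0 // exprn_gt0.
have th0 : 0 <= th by rewrite ltW // divr_gt0 // mulr_gt0 // exprn_gt0.
have kth : k * (1 - th) = 1.
  by rewrite mulrBr mulr1 /th mulrC divfK ?gt_eqF // /k addrK.
have yn j : opbound (\sum_(i < j) y ^+ i) (\sum_(i < j) th ^+ i).
  elim: j => [|j IH]; first by rewrite !big_ord0; exact: opbound0.
  by rewrite !big_ord_recr /=; apply: opboundD => //; apply: opboundX.
have ki : 0 <= k^-1 by rewrite invr_ge0 ltW.
apply: (opboundW (opboundZR ki (yn n))).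
rewrite ler_pdivrMl // mulr1.
have : (1 - th) * \sum_(i < n) th ^+ i <= 1.
  by rewrite -[_ * _]opprK -mulNr opprB -subrX1 opprB gerBl exprn_ge0.
by move=> /(ler_wpM2l (ltW k0)); rewrite mulrA kth mul1r mulr1.
Qed.

Lemma expr_small (x e : R) : 0 <= x -> x < 1 -> 0 < e -> exists n, x ^+ n <= e.
Proof.
move=> x0 x1 e0; have xN : `|x| < 1 by rewrite ger0_norm.
have /cvgrPdist_lt/(_ _ e0)[N _ /(_ N (leqnn N)) /=] := @cvg_expr R x xN.
by rewrite sub0r normrN ger0_norm ?exprn_ge0 // => /ltW; exists N.
Qed.

(** The number of terms depends on [c], [M], [e] only, not on [m] or [h]. This uniformity makes it
    possible to truncate all partial sums by one formula. *)
Lemma dampingP c M e : 0 < c -> 0 < M -> 0 < e -> exists n,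
  forall m (h : H m m), h^s = h -> nrm h <= M ->
  let v := unitz_in T h in let r := damping c M n v in
  [/\ opbound r 1, opbound (v * r) (Num.sqrt (2 / c)) &
      opbound (1 - (1 + c%:C%C *: v ^+ 2) * r) e].
Proof.
move=> c0 M0 e0; pose k := 1 + c * M ^+ 2; pose th := c * M ^+ 2 / k.
have cM0 : 0 < c * M ^+ 2 by rewrite mulr_gt0 // exprn_gt0.
have k0 : 0 < k by rewrite /k addr_gt0.
have th0 : 0 <= th by rewrite divr_ge0 ?ltW.
have th1 : th < 1 by rewrite ltr_pdivrMr // mul1r ltrDr.
have [n thn] := @expr_small _ (Num.min e 1) th0 th1 ltac:(by rewrite lt_min e0 ltr01).
move: thn; rewrite le_min => /andP[thne thn1].
exists n => m h hs hM v r.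
have r1 : opbound r 1 by exact: damping_opbound.
have rs : unitz_star r = r by apply: damping_star; rewrite unitz_star_in hs.
have vs : unitz_star v = v by rewrite unitz_star_in hs.
have vr : v * r = r * v by exact: damping_comm.
have yn : opbound (damping_ratio c M v ^+ n) (th ^+ n).
  by apply: opboundX => //; exact: damping_ratio_opbound.
have rE := damping_resolvent n v k0; rewrite -/r in rE.
clearbody r; split => //; last by rewrite rE opprB addrCA subrr addr0; exact: opboundW thne.
(* [p = sc v r] and [r] commute, are self-adjoint, and their squares add up to
   [r (1 + c v^2) r = r (1 - y^n)] with [y] the ratio; this is bounded by 2 because [y^n] is bounded
   by 1. *)
pose sc := Num.sqrt c; have sc0 : 0 < sc by rewrite sqrtr_gt0.
pose p := sc%:C%C *: (v * r).
have ps : unitz_star p = p by rewrite unitz_starZ conjC_RtoC unitz_starM vs rs -vr.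
have pr : p * r = r * p by rewrite /p -scalerAl -scalerAr mulrA -vr.
have : opbound p (Num.sqrt 2).
  apply: (opbound_sqrD _ ps rs pr); first exact: sqrtr_ge0.
  have -> : p ^+ 2 + r ^+ 2 = r * ((1 + c%:C%C *: v ^+ 2) * r).
    rewrite exprZn -rmorphXn sqr_sqrtr ?ltW // mulrDl mul1r mulrDr -expr2 addrC.
    congr (_ + _); rewrite -scalerAl -scalerAr; congr (_ *: _).
    by rewrite !expr2 {1}vr -!mulrA.
  rewrite rE sqr_sqrtr // -[2]mul1r; apply: opboundM => //.
  apply: opboundW (opboundB (@opbound1 _ _ _ _) yn) _.
  by rewrite -[2]/(1 + 1) lerD2l.
have isc : 0 <= sc^-1 by rewrite invr_ge0 ltW.
move=> /(opboundZR isc); rewrite scalerA -rmorphM mulVf ?gt_eqF // scale1r.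
by rewrite sqrtrM // sqrtrV ?ltW // mulrC.
Qed.

(* With h = j^* j, w is c h^2 R where R approximates (1 + c h^2)^-1 and c is
   large; squares are used because h need not be positive. *)
Lemma approximate_unit n m (j : H n m) e : 0 < e -> exists w v : H m m,
  [/\ w^s = w, w = (j^s ** j) ** v,
      forall l (b : H l m), nrm (b - b ** w) <= (1 + e) * nrm b &
      nrm (j - j ** w) <= e].
Proof.
move=> e0; pose h := j^s ** j; have hs : h^s = h by rewrite hstar_comp hstarK.
pose M := nrm h + 1; have hM : nrm h <= M by rewrite lerDl.
have M0 : 0 < M by rewrite ltr_wpDl ?nrm_ge0.
(* [c] is chosen to make [d] the bound for [v r]: then [||j r||^2 = ||r h r|| <= d], so
   [||j r|| <= e / 2]. The tolerance [e'] makes the remaining term [j E] at most [e / 2] as well. *)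
pose d := (e / 2) ^+ 2; have d0 : 0 < d by rewrite exprn_gt0 // divr_gt0.
pose c := 2 / d ^+ 2; have c0 : 0 < c by rewrite divr_gt0 // exprn_gt0.
have cd : Num.sqrt (2 / c) = d.
  by rewrite /c invf_div mulrCA mulfV // mulr1 sqrtr_sqr gtr0_norm.
pose e' := Num.min e (e / (2 * (nrm j + 1))).
have j1 : 0 < 2 * (nrm j + 1) by rewrite mulr_gt0 // ltr_wpDl ?nrm_ge0.
have e'0 : 0 < e' by rewrite lt_min e0 divr_gt0.
have [k kP] := dampingP c0 M0 e'0.
pose v := unitz_in T h; pose r := damping c M k v; pose E := 1 - (1 + c%:C%C *: v ^+ 2) * r.
have [r1 vr ee] : [/\ opbound r 1, opbound (v * r) d & opbound E e'].
  by rewrite -cd; exact: kP.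
have rs : unitz_star r = r by apply: damping_star; rewrite unitz_star_in hs.
pose z := c%:C%C *: ract h r; pose w := h ** z; exists w, z.
have inw : unitz_in T w = c%:C%C *: v ^+ 2 * r.
  by rewrite unitz_inM unitz_inZ -unitz_in_ract -scalerAr mulrA -expr2 scalerAl.
have wE : 1 - unitz_in T w = r + E.
  by rewrite /E mulrDl mul1r inw opprD addrCA (addrA r) subrr add0r.
have ws : w^s = w.
  have vs : unitz_star v = v by rewrite unitz_star_in hs.
  have : unitz_in T w^s = unitz_in T w.
    rewrite -unitz_star_in inw unitz_starM rs unitz_starZ conjC_RtoC unitz_starX vs.
    by apply: comm_scaler; apply: commrX; apply/commr_sym; exact: damping_comm.
  by case.
have rE l (b : H l m) : b - b ** w = ract b r + ract b E.
  by rewrite -ractDr -wE ractDr ract1 ractNr ract_in.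
have e'e : e' <= e by rewrite ge_min lexx.
split => // [l b|].
  rewrite rE -ractDr mulrC; apply: nrm_ract; first by rewrite addr_ge0 // ltW.
  by apply: opboundD => //; apply: opboundW ee _.
rewrite rE (le_trans (nrmD _ _)) // [leRHS](splitr e) lerD //.
  have e20 : 0 <= e / 2 by rewrite divr_ge0 // ltW.
  rewrite -(@ler_pXn2r _ 2) ?nnegrE ?nrm_ge0 // -(nrm_cstar T).
  rewrite hstar_ract rs lact_hcomp hcomp_ractr (le_trans (r1 _ _)) // mul1r.
  by move: vr; rewrite unitz_in_ract; exact: (nrm_le_opbound (ltW d0)).
rewrite (le_trans (nrm_ract _ (ltW e'0) ee)) //.
have : nrm j * e' <= nrm j * (e / (2 * (nrm j + 1))).
  by rewrite ler_wpM2l ?nrm_ge0 // ge_min lexx orbT.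
move=> /le_trans; apply.
by rewrite mulrA ler_pdivrMr //; have := nrm_ge0 j; nra.
Qed.

End Damping.

(** * Ideals and quotient norms *)

Section Ideals.
Variables (R : realType) (H : nat -> nat -> normedModType R[i]).
Variables (T : cstar_precat H).
Local Notation "a ** b" := (hcomp T a b) (at level 40, left associativity).
Local Notation "a ^s" := (hstar T a) (at level 2, format "a ^s").

Section OneIdeal.
Variables (I : subfamily H) (Ii : is_ideal T I).

Lemma idealZ n m c (a : H n m) : I a -> I (c *: a).
Proof. by move=> Ia; rewrite -[_ *: _]addr0; apply: (ideal_linear Ii) => //; exact: (ideal0 Ii). Qed.
Lemma idealD n m (a b : H n m) : I a -> I b -> I (a + b).
Proof. by move=> Ia Ib; rewrite -[a]scale1r; exact: (ideal_linear Ii). Qed.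
Lemma idealN n m (a : H n m) : I a -> I (- a).
Proof. by rewrite -scaleN1r; exact: idealZ. Qed.
Lemma ideal_approx n m (a : H n m) :
  (forall e : R, 0 < e -> exists2 y, I y & nrm (a - y) <= e) -> I a.
Proof. by apply: closed_approx; exact: (ideal_closed Ii). Qed.

(** The approximate unit [w = a^s a v] lies in the ideal along with [a], and since [w] is
    self-adjoint, [a - a w] small means [a^s - w a^s] small. *)
Lemma ideal_hstar n m (a : H n m) : I a -> I a^s.
Proof.
move=> Ia; apply: ideal_approx => e e0.
have [w [v [ws wE _ jw]]] := approximate_unit T a e0; exists (w ** a^s).
  by apply: (ideal_compr Ii); rewrite wE; apply/(ideal_compr Ii)/(ideal_compl Ii).
by rewrite -ws -hstar_comp -hstarB nrm_hstar.
Qed.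

(* a is a limit of multiples of a a^*. *)
Lemma ideal_of_hcomp_hstar n m (a : H n m) : I (a ** a^s) -> I a.
Proof.
move=> Ia; apply: ideal_approx => e e0.
have [w [v [ws wE _ jw]]] := approximate_unit T a^s e0; exists (w ** a).
  by apply: (ideal_compr Ii); rewrite wE hstarK; exact: (ideal_compr Ii).
by rewrite -(nrm_hstar T) hstarB hstar_comp ws.
Qed.

Lemma ideal_ract n m (x : H n m) (u : unitization m T) : I x -> I (ract x u).
Proof. by move=> Ix; apply: idealD; [exact: (ideal_compr Ii) | exact: idealZ]. Qed.

(** Stands for equality in the unitization of the quotient by [I]. *)
Definition unitz_congr m (u v : unitization m T) := I (u.1 - v.1) /\ u.2 = v.2.

Lemma unitz_congr_refl m (u : unitization m T) : unitz_congr u u.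
Proof. by split; rewrite // subrr; exact: (ideal0 Ii). Qed.
Lemma unitz_congrD m (u v u' v' : unitization m T) :
  unitz_congr u v -> unitz_congr u' v' -> unitz_congr (u + u') (v + v').
Proof.
move=> [uv1 uv2] [uv1' uv2']; split; last by rewrite /= uv2 uv2'.
by rewrite /= opprD addrACA; exact: idealD.
Qed.
Lemma unitz_congrZ m c (u v : unitization m T) :
  unitz_congr u v -> unitz_congr (c *: u) (c *: v).
Proof. by move=> [uv1 uv2]; split; [rewrite /= -scalerBr; exact: idealZ | rewrite /= uv2]. Qed.
Lemma unitz_congrM m (u v u' v' : unitization m T) :
  unitz_congr u v -> unitz_congr u' v' -> unitz_congr (u * u') (v * v').
Proof.
move=> [uv1 uv2] [uv1' uv2']; split; last by rewrite /= uv2 uv2'.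
rewrite -[(u * u').1]/(u.1 ** u'.1 + u.2 *: u'.1 + u'.2 *: u.1).
rewrite -[(v * v').1]/(v.1 ** v'.1 + v.2 *: v'.1 + v'.2 *: v.1) uv2 uv2'.
rewrite opprD addrACA; apply: idealD; first (rewrite opprD addrACA; apply: idealD).
- rewrite -(subrKA (v.1 ** u'.1)) -hcompBl -hcompBr.
  by apply: idealD; [exact: (ideal_compr Ii) | exact: (ideal_compl Ii)].
- by rewrite -scalerBr; exact: idealZ.
- by rewrite -scalerBr; exact: idealZ.
Qed.
Lemma unitz_congrX m (u v : unitization m T) k :
  unitz_congr u v -> unitz_congr (u ^+ k) (v ^+ k).
Proof.
move=> uv; elim: k => [|k IH]; first exact: unitz_congr_refl.
by rewrite !exprS; exact: unitz_congrM.
Qed.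
(** [damping] is a polynomial in its argument. *)
Lemma damping_congr m c M n (u v : unitization m T) :
  unitz_congr u v -> unitz_congr (damping c M n u) (damping c M n v).
Proof.
move=> uv; apply: unitz_congrZ.
elim: n => [|n IH]; first by rewrite !big_ord0; exact: unitz_congr_refl.
rewrite !big_ord_recr /=; apply: unitz_congrD => //; apply: unitz_congrX.
apply: unitz_congrZ; apply: unitz_congrD; first exact: unitz_congr_refl.
by rewrite -scaleN1r -[- v ^+ 2]scaleN1r; apply: unitz_congrZ; exact: unitz_congrX.
Qed.
Lemma ract_congr n m (x y : H n m) (u v : unitization m T) :
  I (x - y) -> unitz_congr u v -> I (ract x u - ract y v).
Proof.
move=> Ixy [uv1 uv2]; rewrite -(subrKA (ract y u)) -(ractNl y u) -ractDl.
apply: idealD; first exact: ideal_ract.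
rewrite /ract uv2 opprD addrACA subrr addr0 -hcompBr; exact: (ideal_compl Ii).
Qed.
Lemma hcomp_congr n m l (x y : H n m) (x' y' : H m l) :
  I (x - y) -> I (x' - y') -> I (x ** x' - y ** y').
Proof.
move=> xy xy'; rewrite -(subrKA (y ** x')) -hcompBl -hcompBr.
by apply: idealD; [exact: (ideal_compr Ii) | exact: (ideal_compl Ii)].
Qed.
Lemma hstar_congr n m (x y : H n m) : I (x - y) -> I (x^s - y^s).
Proof. by rewrite -hstarB; exact: ideal_hstar. Qed.

Local Notation qn := (quotient_norm I).

Lemma quotient_norm_has_inf n m (x : H n m) : has_inf [set nrm (x + y) | y in @I n m].
Proof.
split; first by exists (nrm (x + 0)); exists 0 => //; exact: (ideal0 Ii).
by exists 0 => _ [y _ <-]; exact: nrm_ge0.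
Qed.
Lemma quotient_norm_le n m (x y : H n m) : I (x - y) -> qn x <= nrm y.
Proof.
move=> Ixy; apply: ge_inf; first by case: (quotient_norm_has_inf x).
by exists (y - x); rewrite ?[x + _]addrC ?subrK // -opprB; exact: idealN.
Qed.
Lemma quotient_norm_ge0 n m (x : H n m) : 0 <= qn x.
Proof.
apply: lb_le_inf; first by case: (quotient_norm_has_inf x).
by move=> _ [y _ <-]; exact: nrm_ge0.
Qed.
Lemma quotient_norm_approx n m (x : H n m) (c : R) : qn x < c ->
  exists2 y, I (x - y) & nrm y < c.
Proof.
rewrite -subr_gt0 => /inf_adherent /(_ (quotient_norm_has_inf x)).
move=> [_ [y Iy <-]]; rewrite -/(qn x) [X in _ < X]addrC subrK => xy; exists (x + y) => //.
by rewrite opprD addrA subrr sub0r; exact: idealN.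
Qed.
Lemma quotient_norm_leP n m (x : H n m) (c : R) :
  (forall e, 0 < e -> exists2 y, I (x - y) & nrm y <= c + e) -> qn x <= c.
Proof.
move=> h; apply/ler_addgt0Pr => e /h[y Ixy yc].
exact: le_trans (quotient_norm_le Ixy) yc.
Qed.
Lemma quotient_norm_gt n m (x : H n m) (e : R) : 0 < e ->
  exists2 y, I (x - y) & nrm y <= qn x + e.
Proof.
move=> e0; have [|y Ixy yx] := @quotient_norm_approx _ _ x (qn x + e).
  by rewrite ltrDl.
by exists y => //; exact: ltW.
Qed.
Lemma quotient_norm_nrm n m (x : H n m) : qn x <= nrm x.
Proof. by apply: quotient_norm_le; rewrite subrr; exact: (ideal0 Ii). Qed.
Lemma quotient_norm_mem n m (x : H n m) : I x -> qn x = 0.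
Proof.
move=> Ix; apply: le_anti; rewrite quotient_norm_ge0 andbT -(nrm0 (H n m)).
by apply: quotient_norm_le; rewrite subr0.
Qed.
Lemma quotient_norm_eq0 n m (x : H n m) : qn x <= 0 -> I x.
Proof.
move=> x0; apply: ideal_approx => e e0.
have [y Ixy ye] := quotient_norm_approx (le_lt_trans x0 e0).
by exists (x - y) => //; rewrite opprB addrC subrK ltW.
Qed.
Lemma quotient_normD n m (x y : H n m) : qn (x + y) <= qn x + qn y.
Proof.
apply: quotient_norm_leP => e e0; have e20 : 0 < e / 2 by rewrite divr_gt0.
have [x' Ix xe] := quotient_norm_gt x e20; have [y' Iy ye] := quotient_norm_gt y e20.
exists (x' + y'); first by rewrite opprD addrACA; exact: idealD.
by rewrite (le_trans (nrmD _ _)) // [e]splitr addrACA lerD.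
Qed.
Lemma quotient_normZ_le n m (c : R[i]) (x : H n m) : qn (c *: x) <= complex.Re `|c| * qn x.
Proof.
apply: quotient_norm_leP => e e0; have c0 : 0 <= complex.Re `|c| := nrm_ge0 (c : R[i]^o).
have c1 : 0 < complex.Re `|c| + 1 by rewrite ltr_wpDl.
have [x' Ix xe] := quotient_norm_gt x (divr_gt0 e0 c1).
exists (c *: x'); first by rewrite -scalerBr; exact: idealZ.
rewrite nrmZ (le_trans (ler_wpM2l c0 xe)) // mulrDr lerD2l mulrA ler_pdivrMr //.
by rewrite mulrC ler_wpM2l ?ltW // ltrDl.
Qed.
Lemma quotient_norm_hcomp n m l (x : H n m) (y : H m l) : qn (x ** y) <= qn x * qn y.
Proof.
apply: quotient_norm_leP => e e0.
have x0 := quotient_norm_ge0 x; have y0 := quotient_norm_ge0 y.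
(* Since [d <= 1], [(qn x + d) (qn y + d) <= qn x * qn y + d k]. *)
pose k := qn x + qn y + 1; have k0 : 0 < k by rewrite ltr_wpDl // addr_ge0.
pose d := Num.min 1 (e / k); have d0 : 0 < d by rewrite lt_min ltr01 divr_gt0.
have d1 : d <= 1 by rewrite ge_min lexx.
have dk : d * k <= e by rewrite -ler_pdivlMr // ge_min lexx orbT.
have [x' Ix xe] := quotient_norm_gt x d0; have [y' Iy ye] := quotient_norm_gt y d0.
exists (x' ** y'); first exact: hcomp_congr.
rewrite (le_trans (nrm_hcomp _ _ _)) // (le_trans (ler_pM _ _ xe ye)) ?nrm_ge0 //.
by rewrite /k in dk; nra.
Qed.

(* Multiplying by 1 - w, for an approximate unit w of the ideal, kills a given
   element of the ideal up to e. *)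
Lemma quotient_norm_cstar n m (x : H n m) : qn x ^+ 2 <= qn (x^s ** x).
Proof.
apply: lb_le_inf; first by case: (quotient_norm_has_inf (x^s ** x)).
move=> _ [j Ij <-]; set y := x^s ** x; set N := nrm _.
have N0 : 0 <= N := nrm_ge0 _; apply/ler_addgt0Pr => d d0.
(* For [e <= 1] the final bound [(1 + e) ((1 + e) N + e)] is at most [N + e (3 N + 2)]. *)
have k0 : 0 < 3 * N + 2 by rewrite ltr_wpDl // mulr_ge0.
pose e := Num.min 1 (d / (3 * N + 2)); have e0 : 0 < e by rewrite lt_min ltr01 divr_gt0.
have e1 : e <= 1 by rewrite ge_min lexx.
have ed : e * (3 * N + 2) <= d by rewrite -ler_pdivlMr // ge_min lexx orbT.
have [w [v [ws wE wb jw]]] := approximate_unit T j e0.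
have Iw : I w by rewrite wE; apply/(ideal_compr Ii)/(ideal_compl Ii).
have xw : qn x <= nrm (x - x ** w).
  by apply: quotient_norm_le; rewrite opprB addrC subrK; exact: (ideal_compl Ii).
have xw0 := le_trans (quotient_norm_ge0 x) xw.
apply: (le_trans (_ : _ <= nrm (x - x ** w) ^+ 2)); first by rewrite ler_sqr ?nnegrE ?quotient_norm_ge0.
rewrite -(nrm_cstar T) hstarB hstar_comp ws.
(* This is [(1 - w) y (1 - w)], each factor [1 - w] costing at most [1 + e]. *)
have -> : (x^s - w ** x^s) ** (x - x ** w) = (y - y ** w) - w ** (y - y ** w).
  by rewrite hcompBl !hcompBr !hcompA.
have wb' (z : H m m) : nrm (z - w ** z) <= (1 + e) * nrm z.
  by rewrite -(nrm_hstar T) hstarB hstar_comp ws -(nrm_hstar T z).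
rewrite (le_trans (wb' _)) //.
(* Inserting [j] replaces [||y||] by the quotient candidate [N = ||y + j||], at the price of
   [j (1 - w)], which is at most [e]. *)
have yj : y - y ** w = (y + j) - (y + j) ** w - (j - j ** w).
  by rewrite hcompDl opprD addrACA addrK.
have B : nrm (y - y ** w) <= (1 + e) * N + e.
  by rewrite yj (le_trans (nrmD _ _)) // nrmN; apply: lerD => //; exact: wb.
have e1' : 0 <= 1 + e by rewrite addr_ge0 // ltW.
rewrite (le_trans (ler_wpM2l e1' B)) //.
nra.
Qed.

End OneIdeal.

(** Splits [x (1 - r)]. The first term contains the quintic [x (x^s x)^2], which is small when
    [||x|| <= 1] and may be computed from any element congruent to [x]; the second is the resolvent
    error. *)
Lemma damping_error n m c M k (x : H n m) :
  let v := unitz_in T (x^s ** x) in let r := damping c M k v in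
  x - ract x r = c%:C%C *: ract (x ** (x^s ** x) ** (x^s ** x)) r +
                 ract x (1 - (1 + c%:C%C *: v ^+ 2) * r).
Proof.
move=> v r; have -> : x ** (x^s ** x) ** (x^s ** x) = ract x (v ^+ 2).
  by rewrite expr2 ractM !ract_in.
clearbody r; rewrite -ractM.
have -> : 1 - (1 + c%:C%C *: v ^+ 2) * r = (1 - r) - c%:C%C *: (v ^+ 2 * r).
  by rewrite mulrDl mul1r opprD addrA -scalerAl.
by rewrite [in RHS]ractDr ractNr ractZr [RHS]addrC subrK ractDr ract1 ractNr.
Qed.

(** * Compatibility of damping with the right tensoring *)

Section Naturality.
Variable t : right_tensoring T.

Definition unitz_tens m (u : unitization m T) : unitization m.+1 T :=
  (tens t m m u.1, u.2).

Lemma unitz_tensD m (u v : unitization m T) :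
  unitz_tens (u + v) = unitz_tens u + unitz_tens v.
Proof. by congr (_, _); rewrite /= raddfD. Qed.
Lemma unitz_tensZ m c (u : unitization m T) : unitz_tens (c *: u) = c *: unitz_tens u.
Proof. by congr (_, _); rewrite /= linearZ. Qed.
Lemma unitz_tens1 m : unitz_tens (1 : unitization m T) = 1.
Proof. by congr (_, _); rewrite /= raddf0. Qed.
Lemma unitz_tensM m (u v : unitization m T) :
  unitz_tens (u * v) = unitz_tens u * unitz_tens v.
Proof.
congr (_, _); rewrite -[(u * v).1]/(u.1 ** v.1 + u.2 *: v.1 + v.2 *: u.1).
by rewrite !raddfD /= tens_hcomp !linearZ.
Qed.
Lemma unitz_tensX m (u : unitization m T) k : unitz_tens (u ^+ k) = unitz_tens u ^+ k.
Proof.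
by elim: k => [|k IH]; [exact: unitz_tens1 | rewrite !exprS unitz_tensM IH].
Qed.
Lemma unitz_tens_damping m c M k (u : unitization m T) :
  unitz_tens (damping c M k u) = damping c M k (unitz_tens u).
Proof.
have ratioE : unitz_tens (damping_ratio c M u) = damping_ratio c M (unitz_tens u).
  by rewrite unitz_tensZ unitz_tensD -scaleN1r !unitz_tensZ unitz_tens1 unitz_tensX scaleN1r.
rewrite unitz_tensZ; congr (_ *: _); elim: k => [|k IH].
  by rewrite !big_ord0 -(scale0r 1) unitz_tensZ !scale0r.
by rewrite !big_ord_recr /= unitz_tensD IH unitz_tensX ratioE.
Qed.
Lemma tens_ract n m (x : H n m) (u : unitization m T) :
  tens t n m (ract x u) = ract (tens t n m x) (unitz_tens u).
Proof. by rewrite /ract raddfD /= tens_hcomp linearZ. Qed.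

End Naturality.

(* A universal bounded approximation of the truncation x |-> x min(1, 1/|x|). *)
Lemma truncation (M : R) : exists f : forall n m, H n m -> H n m,
  [/\ forall n m (x : H n m), nrm x <= M -> nrm (f n m x) <= 2,
      forall n m (x : H n m), nrm x <= M -> nrm x <= 1 -> nrm (x - f n m x) <= 4^-1,
      forall I n m (x : H n m), is_ideal T I -> nrm x <= M -> quotient_norm I x < 1 ->
        quotient_norm I (x - f n m x) <= 4^-1,
      forall I n m (x y : H n m), is_ideal T I -> I n m (x - y) ->
        I n m (f n m x - f n m y) &
      (forall (t : right_tensoring T) n m (x : H n m),
        tens t n m (f n m x) = f n.+1 m.+1 (tens t n m x)) /\
      forall n m, f n m 0 = 0].
Proof.
(* [c] and [M1 * e] are both 1/8 and add up to 1/4. Also [sqrt (2 / c) = 4], so with [h = x^s x] and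
   [r] the damping, [||x r||^2 <= ||h r|| <= 4]. *)
pose c : R := 8^-1; have c0 : 0 < c by rewrite invr_gt0.
pose M1 := `|M| + 1; have M10 : 0 < M1 by rewrite ltr_wpDl.
pose e := (8 * M1)^-1; have e0 : 0 < e by rewrite invr_gt0 mulr_gt0.
have [k kP] := dampingP T c0 (exprn_gt0 2 M10) e0.
pose r n m (x : H n m) := damping c (M1 ^+ 2) k (unitz_in T (x^s ** x)).
exists (fun n m x => ract x (r n m x)).
have hM n m (x : H n m) : nrm x <= M -> nrm x <= M1 /\ nrm (x^s ** x) <= M1 ^+ 2.
  move=> xM; have xM1 : nrm x <= M1.
    by rewrite (le_trans xM) // (le_trans (ler_norm _)) // lerDl.
  by split => //; rewrite nrm_cstar ler_sqr ?nnegrE ?nrm_ge0 // ltW.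
have hs n m (x : H n m) : (x^s ** x)^s = x^s ** x by rewrite hstar_comp hstarK.
have cube n m (y : H n m) : nrm y <= 1 -> nrm (y ** (y^s ** y) ** (y^s ** y)) <= 1.
  move=> y1; have y2 : nrm (y^s ** y) <= 1 by rewrite nrm_cstar expr_le1 ?nrm_ge0.
  rewrite (le_trans (nrm_hcomp _ _ _)) // mulr_ile1 ?nrm_ge0 //.
  by rewrite (le_trans (nrm_hcomp _ _ _)) // mulr_ile1 ?nrm_ge0.
have main n m (x : H n m) z : nrm x <= M -> nrm z <= 1 ->
    nrm (c%:C%C *: ract z (r n m x) + ract x (1 - (1 + c%:C%C *:
      unitz_in T (x^s ** x) ^+ 2) * r n m x)) <= 4^-1.
  move=> /hM[xM1 xM2] z1; have [r1 _ E1] := kP _ _ (hs _ _ x) xM2.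
  rewrite (le_trans (nrmD _ _)) // (_ : 4^-1 = c + M1 * e); last first.
    by rewrite /e /c; field; rewrite gt_eqF.
  apply: lerD; last first.
    by rewrite (le_trans (nrm_ract _ (ltW e0) E1)) // ler_wpM2r // ltW.
  rewrite (nrmZR _ (ltW c0)) ler_piMr ?(ltW c0) //.
  by rewrite (le_trans (nrm_ract _ ler01 r1)) // mulr1.
split.
- move=> n m x /hM[xM1 xM2]; have [r1 vr1 _] := kP _ _ (hs _ _ x) xM2.
  rewrite -(@ler_pXn2r _ 2) ?nnegrE ?nrm_ge0 // -(nrm_cstar T).
  rewrite hstar_ract damping_star ?unitz_star_in ?hs //.
  rewrite lact_hcomp hcomp_ractr (le_trans (r1 _ _)) // mul1r.
  rewrite unitz_in_ract in vr1.
  rewrite (le_trans (nrm_le_opbound (sqrtr_ge0 _) vr1)) //.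
  rewrite (_ : 2 / c = 4 ^+ 2); last by rewrite /c; field.
  by rewrite sqrtr_sqr ger0_norm // expr2 -natrM.
- move=> n m x xM x1; rewrite damping_error; apply: main => //; exact: cube.
(* Only the quintic is recomputed from a representative [y] of norm below 1; the damping factor and
   the error term keep [x], whose norm is at most [M]. *)
- move=> I n m x Ii xM /(quotient_norm_approx Ii)[y Ixy /ltW y1].
  apply: le_trans (main _ _ x _ xM (cube _ _ y y1)).
  apply: quotient_norm_le => //; rewrite damping_error opprD addrACA subrr addr0.
  rewrite -scalerBr; apply: idealZ => //; rewrite -ractNl -ractDl.
  apply: ideal_ract => //; apply: (hcomp_congr Ii); first apply: (hcomp_congr Ii) => //.
    by apply: (hcomp_congr Ii) => //; exact: hstar_congr.
  by apply: (hcomp_congr Ii) => //; exact: hstar_congr.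
- move=> I n m x y Ii xy; apply: (ract_congr Ii xy); apply: (damping_congr Ii).
  by split; [apply: (hcomp_congr Ii _ xy); exact: hstar_congr |].
split=> [t n m x|n m]; last by rewrite /ract hcomp0l scaler0 addr0.
rewrite tens_ract unitz_tens_damping; congr (ract _ (damping _ _ _ _)).
by rewrite -tens_hstar -tens_hcomp.
Qed.

End Ideals.

(** * Partial sums of matrices *)

Section Shift.
Variables (R : realType) (H : nat -> nat -> normedModType R[i]).
Variables (T : cstar_precat H) (t : right_tensoring T).
Local Notation "a ** b" := (hcomp T a b) (at level 40, left associativity).
Implicit Types (a b : matr H).

(** Taking the entry from a matrix lets the right-hand side be [a u v], free of casts. *)
Lemma single_at a i j u v :
  single (a i j) u v = if (i == u) && (j == v) then a u v else 0.
Proof.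
rewrite /single; case: (i =P u) => [iu|//]; case: (j =P v) => [jv|//] /=.
by case: v / jv; case: u / iu.
Qed.

Lemma singleE n m (x : H n m) : single x n m = x.
Proof.
rewrite /single; case: (n =P n) => [nn|//]; case: (m =P m) => [mm|//] /=.
by rewrite (eq_axiomK nn) (eq_axiomK mm).
Qed.

Lemma single0 n m : single (0 : H n m) = 0.
Proof.
by apply: matrP => u v; rewrite -[0]/((0 : matr H) n m) single_at; case: ifP.
Qed.

(* Matrix form of the right tensoring: it avoids casts between H n m and
   H (k + n) (k + m). *)
Definition mshift a : matr H := fun u => match u with
  | 0%N => fun v => 0
  | u'.+1 => fun v => match v with
    | 0%N => 0
    | v'.+1 => tens t u' v' (a u' v')
    end
  end.

(* psum a (s + k) s is the sum of all a_(i + k, i) tensored up to H (s + k) s. *)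
Fixpoint psum a u : forall v, H u v := match u with
  | 0%N => a 0%N
  | u'.+1 => fun v => match v with
    | 0%N => a u'.+1 0%N
    | v'.+1 => a u'.+1 v'.+1 + tens t u' v' (psum a u' v')
    end
  end.

Lemma psumE a u v : psum a u v = a u v + mshift (psum a) u v.
Proof. by case: u v => [|u] [|v] //=; rewrite addr0. Qed.

Lemma iter_mshift_out a k u v : (minn u v < k)%N -> iter k mshift a u v = 0.
Proof.
elim: k u v => [|k IH] [|u] [|v] //=; rewrite ?minnSS ?ltnS => uv.
by rewrite IH ?raddf0.
Qed.

(** Unrolling the recursion sums over the number of tensorings; terms past [minn u v] vanish, so any
    cutoff [N] from there on will do. *)
Lemma psum_iter a N u v : (minn u v <= N)%N ->
  psum a u v = \sum_(e < N.+1) iter e mshift a u v.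
Proof.
elim: N u v => [|N IH] u v uvN.
  by rewrite big_ord1 /=; case: u v uvN => [|u] [|v] //; rewrite minnSS.
rewrite psumE big_ord_recl /=; congr (_ + _); case: u v uvN => [|u] [|v] uvN.
- by rewrite big1.
- by rewrite big1.
- by rewrite big1.
by rewrite /= IH ?raddf_sum //; rewrite minnSS ltnS in uvN.
Qed.

Lemma single_tens n m (x : H n m) : single (tens t n m x) = mshift (single x).
Proof.
apply: matrP => u v; have {1}-> : x = single x n m by rewrite singleE.
rewrite (single_at (mshift (single x)) n.+1 m.+1).
case: u v => [|u] [|v]; rewrite ?andbF //= !eqSS.
case: ifP => // nm; rewrite -[X in single X](singleE x) single_at nm raddf0 //.
Qed.

Lemma single_tens_iter k n m (x : H n m) :
  single (tens_iter t k x) = iter k mshift (single x).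
Proof. by elim: k => //= k IH; rewrite single_tens IH. Qed.

Lemma iter_mshift_single a k i j u v : iter k mshift (single (a i j)) u v =
  if (k + i == u)%N && (k + j == v)%N then iter k mshift a u v else 0.
Proof.
elim: k u v => [|k IH] [|u] [|v] /=; rewrite ?andbF ?single_at //.
by rewrite IH !addSn !eqSS; case: ifP => // _; rewrite raddf0.
Qed.

Lemma single_mulE a b i j p q u v : single_mul t (a i j) (b p q) u v =
  if (j <= p)%N then
    if (i + p - j == u)%N && (q == v) then iter (p - j) mshift a u p ** b p v else 0
  else
    if (i == u) && (q + j - p == v)%N then a u j ** iter (j - p) mshift b j v else 0.
Proof.
rewrite /single_mul; case: leqP => jp.
  rewrite (single_at (fun r s => single (tens_iter t (p - j) (a i j)) r p ** b p s)).
  case: ifP => // /andP[/eqP iu _]; rewrite single_tens_iter iter_mshift_single.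
  by rewrite -iu -addnBA // addnC subnK // !eqxx.
rewrite (single_at (fun r s => a r j ** single (tens_iter t (j - p) (b p q)) j s)).
case: ifP => // /andP[_ /eqP qv]; rewrite single_tens_iter iter_mshift_single.
by rewrite -qv -addnBA ?(ltnW jp) // addnC subnK ?(ltnW jp) // !eqxx.
Qed.

Lemma tens_iter0 k n m : tens_iter t k (0 : H n m) = 0.
Proof. by elim: k => //= k ->; rewrite raddf0. Qed.

Lemma single_mul0l n m p l (y : H p l) : single_mul t (0 : H n m) y = 0.
Proof.
by rewrite /single_mul tens_iter0 single0 hcomp0l; case: ifP; rewrite ?hcomp0l single0.
Qed.

Lemma single_mul0r n m p l (x : H n m) : single_mul t x (0 : H p l) = 0.
Proof.
by rewrite /single_mul tens_iter0 single0 hcomp0r; case: ifP; rewrite ?hcomp0r single0.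
Qed.

(** Additive form, to avoid truncated subtraction. *)
Definition on_diagonal n m a := forall i j, a i j != 0 -> (i + m = n + j)%N.

Lemma fsbig_cat_supp (I : choiceType) (V : nmodType) (r s : seq I) (F : I -> V) :
  uniq (r ++ s) -> (forall i, F i != 0 -> i \in r \/ i \in s) ->
  \sum_(i \in [set: I]) F i = \sum_(i <- r) F i + \sum_(i <- s) F i.
Proof.
move=> rs_uniq Frs; rewrite -big_cat [RHS]fsbig_seq //; apply/esym.
apply: fsbig_widen => // i [_] /= irs; apply/eqP; apply/negPn/negP => /Frs iF.
by apply: irs; rewrite mem_cat; apply/orP.
Qed.

Section Product.
Variables (n m l : nat) (a b : matr H).
Hypotheses (ha : on_diagonal n m a) (hb : on_diagonal m l b).

Lemma matr_mul_neq0 (i : (nat * nat) * (nat * nat)) u v :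
  single_mul t (a i.1.1 i.1.2) (b i.2.1 i.2.2) u v != 0 ->
  [/\ (i.1.1 + m = n + i.1.2)%N, (i.2.1 + l = m + i.2.2)%N &
      if (i.1.2 <= i.2.1)%N then (i.1.1 + i.2.1 - i.1.2 = u)%N /\ i.2.2 = v
      else i.1.1 = u /\ (i.2.2 + i.1.2 - i.2.1 = v)%N].
Proof.
move=> i0; split.
- by apply: ha; apply: contra_neq i0 => ->; rewrite single_mul0l.
- by apply: hb; apply: contra_neq i0 => ->; rewrite single_mul0r.
move: i0; rewrite single_mulE; case: leqP => _; case: ifP => [/andP[/eqP ? /eqP ?]|] //.
- by rewrite eqxx.
- by rewrite eqxx.
Qed.

(** A nonzero contribution at [(u, v)] forces the middle index [m + v - l] to be a natural
    number. *)
Lemma matr_mul_eq0 u v : ~ (u + l = n + v /\ l <= m + v)%N -> matr_mul t a b u v = 0.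
Proof.
move=> uv; rewrite /matr_mul (@fsbig_cat_supp _ _ [::] [::]) ?big_nil ?addr0 // => i.
move=> /matr_mul_neq0[h1 h2 h3]; exfalso; apply: uv.
by case: leqP h3 => h4 [h5 h6]; split; lia.
Qed.

(** Contributions that tensor [a], possibly zero times, meet [b] at [(w, v)] and add up to a partial
    sum of [a]. The others meet [a] at [(u, w)] and tensor [b] at least once, whence the shift. *)
Lemma matr_mulE u w v : (u + m = n + w)%N -> (w + l = m + v)%N ->
  matr_mul t a b u v = psum a u w ** b w v + a u w ** mshift (psum b) w v.
Proof.
move=> uw wv; rewrite /matr_mul.
(* [e] counts tensorings; [g] is used from 1 on because [f] already covers [e = 0]. Where [u - e] or
   [v - e] truncates, both sides are 0. *)
pose f e := ((u - e, w - e), (w, v))%N; pose g e := ((u, w), (w - e, v - e))%N.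
rewrite (@fsbig_cat_supp _ _ (map f (iota 0 w.+1)) (map g (iota 1 w))); first last.
- move=> [[i j] [p q]] /matr_mul_neq0[h1 h2 h3]; rewrite /= in h1 h2 h3.
  case: leqP h3 => h4 [h5 h6].
    left; have -> : ((i, j), (p, q)) = f (w - j)%N by congr (_, _, (_, _)); lia.
    by rewrite map_f // mem_iota; lia.
  right; have -> : ((i, j), (p, q)) = g (w - p)%N by congr (_, _, (_, _)); lia.
  by rewrite map_f // mem_iota; lia.
- rewrite cat_uniq; apply/and3P; split.
  + rewrite map_inj_in_uniq ?iota_uniq // => x y; rewrite !mem_iota /f => xw yw [] *; lia.
  + apply/hasPn => _ /mapP[e + ->]; rewrite mem_iota => ew.
    by apply/mapP => -[x]; rewrite mem_iota /f /g => xw [] *; lia.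
  + rewrite map_inj_in_uniq ?iota_uniq // => x y; rewrite !mem_iota /g => xw yw [] *; lia.
rewrite !big_map; congr (_ + _).
  rewrite (@psum_iter _ w) ?geq_minr // -(big_mkord xpredT (fun e => iter e mshift a u w)).
  rewrite (big_morph (fun x => x ** b w v) (fun x y => hcompDl T x y _) (hcomp0l T _ _)).
  rewrite /index_iota subn0; apply: eq_big_seq => e; rewrite mem_iota => ew.
  rewrite /= single_mulE leq_subr eqxx andbT (_ : w - (w - e) = e)%N; last lia.
  case: eqP => // ue; rewrite iter_mshift_out ?hcomp0l //.
  by rewrite gtn_min; apply/orP; left; lia.
have -> : mshift (psum b) w v = \sum_(e <- iota 1 w) iter e mshift b w v.
  apply: (addrI (b w v)); rewrite -psumE (@psum_iter _ w) ?geq_minl //.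
  by rewrite -(big_mkord xpredT (fun e => iter e mshift b w v)) /index_iota subn0 big_cons.
rewrite (big_morph (fun x => a u w ** x) (fun x y => hcompDr T _ x y) (hcomp0r T _ _)).
apply: eq_big_seq => e; rewrite mem_iota => ew.
rewrite /= single_mulE leqNgt (_ : w - e < w)%N; last lia.
rewrite eqxx /= (_ : w - (w - e) = e)%N; last lia.
case: eqP => // ue; rewrite iter_mshift_out ?hcomp0r //.
by rewrite gtn_min; apply/orP; right; lia.
Qed.

Lemma psum_mul_eq0 u v :
  ~ (u + l = n + v /\ l <= m + v)%N -> psum (matr_mul t a b) u v = 0.
Proof.
elim: u v => [|u IH] [|v] uv; rewrite psumE matr_mul_eq0 //= ?addr0 // add0r.
by rewrite IH ?raddf0 // => -[h1 h2]; apply: uv; lia.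
Qed.

(* Abel summation: by matr_mulE each entry of the product is an increment of
   the product of the partial sums. *)
Lemma psum_mul u w v : (u + m = n + w)%N -> (w + l = m + v)%N ->
  psum (matr_mul t a b) u v = psum a u w ** psum b w v.
Proof.
elim: u w v => [|u IH] w v uw wv; rewrite [LHS]psumE (matr_mulE uw wv).
  by rewrite addr0 [psum b w v]psumE hcompDr.
case: w v uw wv => [|w] [|v] uw wv /=.
- by rewrite hcomp0r !addr0.
(* Middle index 0: one step down the diagonal no middle index is left, so the previous partial sum
   of the product vanishes. *)
- by rewrite psum_mul_eq0 ?raddf0 ?hcomp0r ?addr0 // => -[h1 h2]; lia.
- by rewrite hcomp0r !addr0.
rewrite (IH w v) ?tens_hcomp; [|lia|lia].
by rewrite -addrA -hcompDl -hcompDr.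
Qed.

End Product.
End Shift.

(** * Linearity and involution of partial sums, and their link to the diagonal sums *)

Section PartialSums.
Variables (R : realType) (H : nat -> nat -> normedModType R[i]).
Variables (T : cstar_precat H) (t : right_tensoring T).
Implicit Types (a b : matr H).

Lemma psum_linear c a b u v :
  psum t (c *: a + b) u v = c *: psum t a u v + psum t b u v.
Proof.
elim: u v => [|u IH] [|v] //=.
by rewrite IH linearP scalerDr addrACA.
Qed.

Lemma psumD a b u v : psum t (a + b) u v = psum t a u v + psum t b u v.
Proof. by rewrite -[a]scale1r psum_linear !scale1r. Qed.
Lemma psum0 u v : psum t 0 u v = 0.
Proof. by apply: (addrI (psum t 0 u v)); rewrite -psumD !addr0. Qed.
Lemma psumZ c a u v : psum t (c *: a) u v = c *: psum t a u v.
Proof. by rewrite -[c *: a]addr0 psum_linear psum0 addr0. Qed.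
Lemma psumN a u v : psum t (- a) u v = - psum t a u v.
Proof. by rewrite -scaleN1r psumZ scaleN1r. Qed.
Lemma psumB a b u v : psum t (a - b) u v = psum t a u v - psum t b u v.
Proof. by rewrite psumD psumN. Qed.

Lemma psum_star a u v : psum t (matr_star T a) v u = hstar T (psum t a u v).
Proof. by elim: u v => [|u IH] [|v] //=; rewrite IH tens_hstar -hstarD. Qed.

Lemma diag_sum_psum k s a : 0 <= s%:Z + k ->
  diag_sum t k s a = psum t a (absz (s%:Z + k)) s.
Proof.
move=> sk; rewrite (@psum_iter _ _ _ _ _ s) ?geq_minr //.
(* The reversal matches column [i] with [s - i] tensorings; columns with [i + k < 0] match shifts
   that vanish. *)
rewrite /diag_sum big_mkcond [RHS](reindex_inj rev_ord_inj) /=; apply: eq_bigr => i _.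
rewrite subSS; have is_ := ltn_ord i; case: ifP => ik.
  rewrite single_tens_iter iter_mshift_single ifT //; apply/andP; split; lia.
by rewrite iter_mshift_out // gtn_min; apply/orP; left; lia.
Qed.

Lemma diag_sum_eq0 k s a : s%:Z + k < 0 -> diag_sum t k s a = 0.
Proof. by move=> sk; rewrite /diag_sum big_pred0 // => i; have := ltn_ord i; lia. Qed.

(** On a fixed diagonal [j] determines [i], so [j <= m] already gives finite support. *)
Lemma gradedP (K : ideal T) n m a : reflect
  ((forall i j, (K : subfamily H) i j (a i j)) /\
   forall i j, a i j != 0 -> (i + m = n + j)%N /\ (j <= m)%N)
  (a \in graded K n m).
Proof.
apply: (iffP (asboolP _)) => [[[aK _] am]|[aK am]].
  by split=> // i j /am[] h1 h2; split=> //; lia.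
split; last by move=> i j /am[] h1 h2; split=> //; lia.
split=> //; apply: (@sub_finite_set _ _ ((fun j => (n + j - m, j)%N) @` `I_m.+1)).
  by move=> [i j] /= /am[h1 h2]; exists j => //; congr (_, _); lia.
exact/finite_image/finite_II.
Qed.

End PartialSums.

(** * The relative seminorm *)

Section RelativeSeminorm.
Variables (R : realType) (H : nat -> nat -> normedModType R[i]).
Variables (T : cstar_precat H) (t : right_tensoring T) (J K : ideal T).
Local Notation qn := (quotient_norm J).
Local Notation Ji := (idealP J).
Local Notation Ki := (idealP K).
Local Notation p := (norm_J t J).

Lemma mx_diagonal n m (a : Mspace K n m) : on_diagonal n m (mx a).
Proof. by move=> i j; have /gradedP[_ /[apply] -[]] := mxP a. Qed.

Arguments mx_diagonal {n m} a.

Lemma mx_out n m (a : Mspace K n m) i j : (m < j)%N -> mx a i j = 0.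
Proof.
move=> mj; apply/eqP; apply/negPn/negP; have /gradedP[_ /[apply] -[_]] := mxP a.
by rewrite leqNgt mj.
Qed.

Lemma mx_mem n m (a : Mspace K n m) i j : (K : subfamily H) i j (mx a i j).
Proof. by have /gradedP[] := mxP a. Qed.

Lemma mxD n m (a b : Mspace K n m) : mx (a + b) = mx a + mx b.
Proof. by []. Qed.
Lemma mxN n m (a : Mspace K n m) : mx (- a) = - mx a.
Proof. by []. Qed.
Lemma mxZ n m c (a : Mspace K n m) : mx (c *: a) = c *: mx a.
Proof. by []. Qed.

(** Working form of the seminorm: pairs of naturals replace the integer offset, diagonal sums become
    [psum], and the sums that are empty because [s + k < 0] contribute 0. *)
Lemma norm_J_leP n m (a : Mspace K n m) (c : R) : 0 <= c ->
  p a <= c <->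
  (forall u v, (u + m = n + v)%N -> (v < m)%N -> qn (psum t (mx a) u v) <= c) /\
  nrm (psum t (mx a) n m) <= c.
Proof.
move=> c0; rewrite /norm_J ge_max.
have -> : nrm (diag_sum t (n%:Z - m%:Z) m (mx a)) = nrm (psum t (mx a) n m).
  rewrite diag_sum_psum; last lia.
  by have -> : absz (m%:Z + (n%:Z - m%:Z)) = n by lia.
split=> [/andP[/bigmax_leP[_ h] ->]|[h ->]].
  split=> // u v uv vm; have := h (Ordinal vm) isT.
  rewrite /= diag_sum_psum; last lia.
  by have -> : absz (v%:Z + (n%:Z - m%:Z)) = u by lia.
rewrite andbT; apply/bigmax_leP; split=> // s _.
have [sk|sk] := leP 0 (s%:Z + (n%:Z - m%:Z)).
  by rewrite diag_sum_psum // h //; have := ltn_ord s; lia.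
by rewrite diag_sum_eq0 // (quotient_norm_mem Ji) //; exact: (ideal0 Ji).
Qed.

Lemma norm_J_ge0 n m (a : Mspace K n m) : 0 <= p a.
Proof. by rewrite /norm_J le_max nrm_ge0 orbT. Qed.

Lemma norm_J_quotient n m (a : Mspace K n m) u v : (u + m = n + v)%N -> (v < m)%N ->
  qn (psum t (mx a) u v) <= p a.
Proof. by have [h _] := (norm_J_leP a (norm_J_ge0 a)).1 (lexx _); exact: h. Qed.

Lemma norm_J_nrm n m (a : Mspace K n m) : nrm (psum t (mx a) n m) <= p a.
Proof. by have [] := (norm_J_leP a (norm_J_ge0 a)).1 (lexx _). Qed.

Lemma norm_J_quotient_le n m (a : Mspace K n m) u v : (u + m = n + v)%N -> (v <= m)%N ->
  qn (psum t (mx a) u v) <= p a.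
Proof.
move=> uv; rewrite leq_eqVlt => /orP[/eqP vm|]; last exact: norm_J_quotient.
have un : u = n by lia.
by subst u v; rewrite (le_trans (quotient_norm_nrm Ji _)) ?norm_J_nrm.
Qed.

Lemma norm_J_ext_le n m n' m' (a : Mspace K n m) (b : Mspace K n' m') :
  n = n' -> m = m' ->
  (forall u v, (u + m = n + v)%N -> psum t (mx a) u v = psum t (mx b) u v) ->
  p a <= p b.
Proof.
move=> nn mm; subst n' m' => ab; apply/norm_J_leP; first exact: norm_J_ge0.
split=> [u v uv vm|]; first by rewrite ab // norm_J_quotient.
by rewrite ab ?norm_J_nrm.
Qed.

Lemma norm_J_ext n m (a b : Mspace K n m) :
  (forall u v, (u + m = n + v)%N -> psum t (mx a) u v = psum t (mx b) u v) ->
  p a = p b.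
Proof.
by move=> ab; apply: le_anti; rewrite !norm_J_ext_le // => u v uv; rewrite ab.
Qed.

Lemma norm_J_seminorm n m : seminorm (@norm_J R H T t K J n m).
Proof.
have pZ (c : R[i]) (x : Mspace K n m) : p (c *: x) <= complex.Re `|c| * p x.
  have c0 : 0 <= complex.Re `|c| := nrm_ge0 (c : R[i]^o).
  apply/norm_J_leP; first by rewrite mulr_ge0 ?norm_J_ge0.
  split=> [u v uv vm|]; rewrite mxZ psumZ.
    by rewrite (le_trans (quotient_normZ_le Ji _ _)) // ler_wpM2l // norm_J_quotient.
  by rewrite nrmZ ler_wpM2l // norm_J_nrm.
split=> [x y|c x].
  apply/norm_J_leP; first by rewrite addr_ge0 ?norm_J_ge0.
  split=> [u v uv vm|]; rewrite mxD psumD.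
    by rewrite (le_trans (quotient_normD Ji _ _)) // lerD ?norm_J_quotient.
  by rewrite (le_trans (nrmD _ _)) // lerD ?norm_J_nrm.
(* The reverse inequality is [pZ] for the scalar [c^-1] and the element [c *: x]. *)
apply: le_anti; rewrite pZ andTb; have [->|c0] := eqVneq c 0.
  by rewrite normr0 /= mul0r norm_J_ge0.
have cV : complex.Re `|c^-1| * complex.Re `|c| = 1.
  have cE (z : R[i]) : (complex.Re `|z|)%:C%C = `|z| by exact/esym/(nrmE (z : R[i]^o)).
  by apply: complexI; rewrite rmorphM /= !cE -normrM mulVf // normr1.
have := pZ c^-1 (c *: x); rewrite scalerA mulVf // scale1r => pcx.
rewrite -[leRHS]mul1r -cV mulrAC [leRHS]mulrC ler_wpM2l //.
exact: nrm_ge0 (c : R[i]^o).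
Qed.

Fact mmul_subproof n m l (a : Mspace K n m) (b : Mspace K m l) :
  matr_mul t (mx a) (mx b) \in graded K n l.
Proof.
have da := mx_diagonal a; have db := mx_diagonal b.
apply/gradedP; split=> i j.
  have [/andP[/eqP ij lj]|ij] := boolP ((i + l == n + j) && (l <= m + j))%N.
    rewrite (@matr_mulE _ _ _ _ _ _ _ _ _ da db _ (m + j - l)); [|lia|lia].
    apply: (idealD Ki); first by apply: (ideal_compl Ki); exact: mx_mem.
    by apply: (ideal_compr Ki); exact: mx_mem.
  rewrite (matr_mul_eq0 _ da db); first exact: (ideal0 Ki).
  by case=> /eqP h1 h2; rewrite h1 h2 in ij.
move=> ij0.
have [/andP[/eqP ij lj]|ij] := boolP ((i + l == n + j) && (l <= m + j))%N; last first.
  move: ij0; rewrite (matr_mul_eq0 _ da db) ?eqxx //.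
  by case=> /eqP h1 h2; rewrite h1 h2 in ij.
(* Past column [l] the middle index exceeds [m], so each of the two products in [matr_mulE] has a
   zero factor. *)
split=> //; rewrite leqNgt; apply/negP => lj'; move: ij0.
rewrite (@matr_mulE _ _ _ _ _ _ _ _ _ da db _ (m + j - l)); [|lia|lia].
by rewrite (mx_out b) // (mx_out a) ?hcomp0r ?hcomp0l ?addr0 ?eqxx //; lia.
Qed.
Definition mmul n m l (a : Mspace K n m) (b : Mspace K m l) := MSpace (mmul_subproof a b).

Fact mstar_subproof n m (a : Mspace K n m) : matr_star T (mx a) \in graded K m n.
Proof.
apply/gradedP; split=> i j; first exact/(ideal_hstar Ki)/mx_mem.
move=> ij; have /gradedP[_ /(_ j i)] := mxP a.
case; last by move=> h1 h2; split; lia.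
by apply: contra_neq ij; rewrite /matr_star => ->; exact: hstar0.
Qed.
Definition mstar n m (a : Mspace K n m) := MSpace (mstar_subproof a).

Fact mincl_subproof n m (a : Mspace K n m) : mx a \in graded K n.+1 m.+1.
Proof.
have /gradedP[aK am] := mxP a; apply/gradedP; split=> // i j /am[h1 h2]; split; lia.
Qed.
Definition mincl n m (a : Mspace K n m) := MSpace (mincl_subproof a).

Lemma psum_mmul n m l (a : Mspace K n m) (b : Mspace K m l) u w v :
  (u + m = n + w)%N -> (w + l = m + v)%N ->
  psum t (mx (mmul a b)) u v = hcomp T (psum t (mx a) u w) (psum t (mx b) w v).
Proof. by move=> uw wv; apply: (psum_mul t (mx_diagonal a) (mx_diagonal b)). Qed.

Lemma psum_mmul_eq0 n m l (a : Mspace K n m) (b : Mspace K m l) u v :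
  (v + m < l)%N -> psum t (mx (mmul a b)) u v = 0.
Proof.
move=> vm; apply: (psum_mul_eq0 t (mx_diagonal a) (mx_diagonal b)) => -[]; lia.
Qed.

Lemma psum_mstar n m (a : Mspace K n m) u v :
  psum t (mx (mstar a)) v u = hstar T (psum t (mx a) u v).
Proof. exact: psum_star. Qed.

Lemma norm_J_mmul n m l (a : Mspace K n m) (b : Mspace K m l) :
  p (mmul a b) <= p a * p b.
Proof.
have ab0 : 0 <= p a * p b by rewrite mulr_ge0 ?norm_J_ge0.
apply/norm_J_leP => //; split=> [u v uv vl|]; last first.
  rewrite (@psum_mmul _ _ _ _ _ _ m) // (le_trans (nrm_hcomp _ _ _)) //.
  by rewrite ler_pM ?nrm_ge0 ?norm_J_nrm.
have [lm|lm] := leqP l (v + m); last first.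
  by rewrite psum_mmul_eq0 // (quotient_norm_mem Ji) //; exact: (ideal0 Ji).
rewrite (@psum_mmul _ _ _ _ _ _ (v + m - l)); [|lia|lia].
rewrite (le_trans (quotient_norm_hcomp Ji _ _)) //.
by rewrite ler_pM ?(quotient_norm_ge0 Ji) ?norm_J_quotient //; lia.
Qed.

(** Componentwise: the C*-identity of [T] handles the top partial sum, and [quotient_norm_cstar] the
    lower ones. *)
Lemma norm_J_cstar_le n m (a : Mspace K n m) : p a ^+ 2 <= p (mmul (mstar a) a).
Proof.
have q0 := norm_J_ge0 (mmul (mstar a) a).
have s0 := sqrtr_ge0 (p (mmul (mstar a) a)).
rewrite -[leRHS](sqr_sqrtr q0) ler_sqr ?nnegrE ?norm_J_ge0 //.
apply/norm_J_leP => //; split=> [u v uv vm|].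
  rewrite -(ler_sqr (quotient_norm_ge0 Ji _) s0) (sqr_sqrtr q0).
  rewrite (le_trans (quotient_norm_cstar Ji _)) // -psum_mstar -psum_mmul //; last lia.
  by rewrite norm_J_quotient // addnC.
rewrite -(ler_sqr (nrm_ge0 _) s0) (sqr_sqrtr q0) -(nrm_cstar T) -psum_mstar.
by rewrite -psum_mmul // norm_J_nrm.
Qed.

Lemma mstarK n m (a : Mspace K n m) : mstar (mstar a) = a.
Proof. by apply: val_inj; apply: matrP => i j; exact: hstarK. Qed.

Lemma norm_J_mstar_le n m (a : Mspace K n m) : p a <= p (mstar a).
Proof.
have [a0|a0] := leP (p a) 0; first by rewrite (le_trans a0) ?norm_J_ge0.
by rewrite -(ler_pM2r a0) -expr2 (le_trans (norm_J_cstar_le a)) // norm_J_mmul.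
Qed.

Lemma norm_J_mstar n m (a : Mspace K n m) : p (mstar a) = p a.
Proof.
by apply: le_anti; rewrite norm_J_mstar_le andbT -{2}(mstarK a) norm_J_mstar_le.
Qed.

Lemma norm_J_cstar n m (a : Mspace K n m) : p (mmul (mstar a) a) = p a ^+ 2.
Proof.
apply: le_anti; rewrite norm_J_cstar_le andbT (le_trans (norm_J_mmul _ _)) //.
by rewrite norm_J_mstar expr2.
Qed.

(** The former top partial sum is now measured modulo [J], which can only decrease it, and the new
    top one is its tensoring. *)
Lemma norm_J_mincl n m (a : Mspace K n m) : p (mincl a) <= p a.
Proof.
apply/norm_J_leP; first exact: norm_J_ge0.
split=> [u v uv vm|]; first by apply: (@norm_J_quotient_le n m a); lia.
by rewrite /= mx_out // add0r (le_trans (tens_contractive _ _)) // norm_J_nrm.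
Qed.

End RelativeSeminorm.

(** * Completeness *)

Section FastCauchy.
Variables (R : realType) (V : normedModType R[i]).

Lemma geometric_small (C e : R) : 0 <= C -> 0 < e -> exists N, forall k, (N <= k)%N ->
  C * (2^-1) ^+ k <= e.
Proof.
move=> C0 e0; have C1 : 0 < C + 1 by rewrite ltr_wpDl.
have h1 : (2^-1 : R) < 1 by rewrite invf_lt1 // ltr1n.
have h0 : (0 : R) <= 2^-1 by rewrite invr_ge0.
have [N Ne] := expr_small h0 h1 (divr_gt0 e0 C1); exists N => k Nk.
have kN : (2^-1 : R) ^+ k <= e / (C + 1).
  by rewrite (le_trans _ Ne) // ler_wiXn2l // ltW.
rewrite (le_trans (ler_wpM2l C0 kN)) // mulrA ler_pdivrMr // mulrC ler_wpM2l ?ltW //.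
by rewrite ltrDl.
Qed.

(** Pick centres of balls of radius [8^-1 * 2^-k] in the filter: consecutive balls meet, so the
    centres are within [3/16 * 2^-k] of each other. *)
Lemma complete_of_fast_cauchy :
  (forall x : nat -> V, (forall k, nrm (x k.+1 - x k) <= 4^-1 * (2^-1) ^+ k) ->
     exists l, forall e : R, 0 < e ->
       exists N, forall k, (N <= k)%N -> nrm (l - x k) <= e) ->
  forall F : set_system V, ProperFilter F -> cauchy F -> cvg F.
Proof.
move=> fast F FF /cauchyP Fc; pose r k : R := 8^-1 * (2^-1) ^+ k.
have r0 k : 0 < r k by rewrite mulr_gt0 // ?invr_gt0 // exprn_gt0 // invr_gt0.
have /choice[x xF] : forall k, exists x, F (ball x (r k)%:C%C).
  by move=> k; apply: Fc; rewrite /= ltcR.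
have [k|l lP] := fast x.
  have [y []] := filter_ex (filterI (xF k) (xF k.+1)).
  rewrite -!ball_normE /= !nrm_ltP => xy xy'.
  rewrite -(subrKA y) (le_trans (nrmD _ _)) // [nrm (y - _)]nrmB addrC.
  rewrite (le_trans (lerD (ltW xy) (ltW xy'))) // /r exprS.
  have := ltW (r0 k); rewrite /r; lra.
apply/cvg_ex; exists l => B /nbhs_ballP[_ /= /gt0_complex[e e0 ->] eB].
have e20 : 0 < e / 2 by rewrite divr_gt0.
have [N1 N1P] := lP _ e20.
have [N2 N2P] := geometric_small (ltW (r0 0)) e20.
apply: filterS (xF (maxn N1 N2)); apply: subset_trans eB => y.
rewrite -!ball_normE /= !nrm_ltP => xy.
rewrite -(subrKA (x (maxn N1 N2))) (le_lt_trans (nrmD _ _)) // [e]splitr.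
rewrite ler_ltD ?N1P ?leq_maxl //; apply: lt_le_trans xy _.
by have := N2P _ (leq_maxr N1 N2); rewrite /r expr0 mulr1.
Qed.

End FastCauchy.

Section Completeness.
Variables (R : realType) (H : nat -> nat -> normedModType R[i]).
Variables (T : cstar_precat H) (t : right_tensoring T) (J K : ideal T).
Local Notation Ji := (idealP J).
Local Notation Ki := (idealP K).
Local Notation p := (norm_J t J).

Lemma psum_nrm (a : matr H) (e : R) : 0 <= e -> (forall i j, nrm (a i j) <= e) ->
  forall u v, nrm (psum t a u v) <= v.+1%:R * e.
Proof.
move=> e0 ae; have aE u v : nrm (a u v) <= v.+1%:R * e.
  by rewrite (le_trans (ae _ _)) // ler_peMl // ler1n.
elim=> [|u IH] [|v] //=; rewrite (le_trans (nrmD _ _)) // -natr1 mulrDl mul1r addrC.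
by rewrite lerD ?ae // (le_trans (tens_contractive _ _)).
Qed.

(** Entrywise norm convergence thus implies convergence for [norm_J], since tensoring is contractive
    and a partial sum has at most [m + 1] terms. *)
Lemma norm_J_entries n m (a : Mspace K n m) (e : R) : 0 <= e ->
  (forall i j, nrm (mx a i j) <= e) -> p a <= m.+1%:R * e.
Proof.
move=> e0 ae; have h v : (v <= m)%N -> v.+1%:R * e <= m.+1%:R * e.
  by move=> vm; rewrite ler_wpM2r // ler_nat.
apply/norm_J_leP; first by rewrite mulr_ge0.
split=> [u v uv vm|]; last exact: psum_nrm.
rewrite (le_trans (quotient_norm_nrm Ji _)) // (le_trans (psum_nrm e0 ae _ _)) //.
by rewrite h // ltnW.
Qed.

(* The matrix with partial sums x on the (n, m) diagonal. *)
Definition entries_of n m (x : matr H) : matr H := fun u v =>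
  if (u + m == n + v)%N && (v <= m)%N then x u v - mshift t x u v else 0.

(** Taking differences along the diagonal inverts taking partial sums. *)
Lemma psum_entries_of n m x u v : (u + m = n + v)%N -> (v <= m)%N ->
  psum t (entries_of n m x) u v = x u v.
Proof.
elim: u v => [|u IH] v uv vm; rewrite psumE {1}/entries_of uv vm eqxx /=.
  by rewrite subr0 addr0.
case: v uv vm => [|v] uv vm /=; first by rewrite subr0 addr0.
by rewrite IH ?subrK //; [lia | exact: ltnW].
Qed.

(** Truncate every partial sum of [a] and take differences: each entry of [b] is a difference of two
    elements of norm at most 2. *)
Lemma norm_J_lift n m (a : Mspace K n m) : p a < 1 ->
  exists b : Mspace K n m, (forall i j, nrm (mx b i j) <= 4) /\ p (a - b) <= 4^-1.
Proof.
(* [M] bounds all partial sums at once, so that a single truncation applies to them. *)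
move=> a1; pose N v := nrm (psum t (mx a) (n + v - m) v).
pose M := \sum_(v < m.+1) N v.
have aM u v : (u + m = n + v)%N -> (v <= m)%N -> nrm (psum t (mx a) u v) <= M.
  move=> uv vm; rewrite /M (bigD1 (Ordinal (vm : (v < m.+1)%N))) //= {1}/N.
  have -> : (n + v - m = u)%N by lia.
  by rewrite lerDl; apply: sumr_ge0 => i _; exact: nrm_ge0.
have [f [f2 f1 fJ fK [ft f0]]] := truncation T M.
pose x : matr H := fun u v => f u v (psum t (mx a) u v).
have bP : entries_of n m x \in graded K n m.
  apply/gradedP; split=> i j; last first.
    by rewrite /entries_of; case: ifP => [/andP[/eqP ij jm] _ //|_]; rewrite eqxx.
  rewrite /entries_of; case: ifP => [/andP[/eqP ij jm]|_]; last exact: (ideal0 Ki).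
  (* Entries of [b] lie in [K]: truncation commutes with tensoring and respects congruence modulo
     [K], and a partial sum of [a] differs from the previous one, tensored, by an entry of [a]. *)
  have mem0 : x i j - f i j (mshift t (psum t (mx a)) i j) = x i j - mshift t x i j.
    by congr (_ - _); case: i {ij} => [|i]; case: j {jm} => [|j] //=; rewrite ?f0 ?ft.
  rewrite -mem0; apply: (fK _ _ _ _ _ Ki); rewrite psumE addrK; exact: mx_mem.
exists (MSpace bP); split=> [i j|].
  rewrite /= /entries_of; case: ifP => [/andP[/eqP ij jm]|_]; last by rewrite nrm0.
  rewrite (le_trans (nrmD _ _)) // nrmN (_ : 4 = 2 + 2 :> R); last by rewrite -natrD.
  apply: lerD; first by apply: f2; exact: aM.
  case: i j ij jm => [|i] [|j] ij jm; rewrite ?nrm0 //=.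
  rewrite (le_trans (tens_contractive _ _)) // f2 //; apply: aM; lia.
have psumE' u v : (u + m = n + v)%N -> (v <= m)%N ->
    psum t (mx (a - MSpace bP)) u v = psum t (mx a) u v - f u v (psum t (mx a) u v).
  by move=> uv vm; rewrite mxD mxN psumB /= psum_entries_of.
apply/norm_J_leP; first by rewrite invr_ge0.
split=> [u v uv vm|].
  have vm' := ltnW vm; rewrite psumE' //; apply: (fJ _ _ _ _ Ji); first exact: aM.
  by apply: le_lt_trans a1; exact: norm_J_quotient.
rewrite psumE' //; apply: f1; first exact: aM.
exact: le_trans (norm_J_nrm _ _ _) (ltW a1).
Qed.

(** [p a < c] sits under the existential so that [choice] yields a function defined on all
    matrices. *)
Lemma norm_J_liftZ n m (a : Mspace K n m) (c : R) : 0 < c ->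
  exists b : Mspace K n m,
    p a < c -> (forall i j, nrm (mx b i j) <= 4 * c) /\ p (a - b) <= 4^-1 * c.
Proof.
move=> c0; have [ac|ac] := ltP (p a) c; last by exists 0.
have ci0 : 0 <= c^-1 by rewrite invr_ge0 ltW.
have sn := @norm_J_seminorm R H T t J K n m.
have pZR (k : R) (x : Mspace K n m) : 0 <= k -> p (k%:C%C *: x) = k * p x.
  by move=> k0; rewrite (seminormZ sn) ger0_norm ?lecR.
have [|b [b4 pb]] := @norm_J_lift n m (c^-1%:C%C *: a).
  by rewrite pZR // mulrC ltr_pdivrMr // mul1r.
exists (c%:C%C *: b) => _; split=> [i j|].
  by rewrite mxZ (nrmZR _ (ltW c0)) mulrC ler_wpM2r // ltW.
have -> : a - c%:C%C *: b = c%:C%C *: (c^-1%:C%C *: a - b).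
  by rewrite scalerBr scalerA -rmorphM mulfV ?gt_eqF // scale1r.
by rewrite (pZR _ _ (ltW c0)) mulrC ler_wpM2r // ltW.
Qed.

(** Lift the successive residues: their sums [B k] follow [a k] up to [r k], and their entries form
    norm convergent sequences in [T], whose limits give [l]. *)
Lemma norm_J_complete n m (a : nat -> Mspace K n m) :
  (forall k, p (a k.+1 - a k) <= 4^-1 * (2^-1) ^+ k) ->
  exists l : Mspace K n m, forall e : R, 0 < e ->
    exists N, forall k, (N <= k)%N -> p (l - a k) <= e.
Proof.
move=> a_fast; have sn := @norm_J_seminorm R H T t J K n m.
(* [D] exceeds [p (a 0)], so the induction starts at the zero matrix, and exceeds 1, so
   [(1 + D) / 4 < D / 2] in the inductive step. *)
pose D := p (a 0%N) + 2; have D1 : 1 < D by rewrite ltr_wpDl ?norm_J_ge0 // ltr1n.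
have D0 : 0 < D := lt_trans ltr01 D1.
pose r k : R := D * (2^-1) ^+ k.
have r0 k : 0 < r k by rewrite mulr_gt0 // exprn_gt0 // invr_gt0.
have [g gP] := choice (fun kd : nat * Mspace K n m => norm_J_liftZ kd.2 (r0 kd.1)).
have [B [B0 BS]] : exists B : nat -> Mspace K n m,
    B 0%N = 0 /\ forall k, B k.+1 = B k + g (k, a k - B k).
  exists (fix B k := if k is k'.+1 then B k' + g (k', a k' - B k') else 0); by split.
have aB k : p (a k - B k) < r k.
  elim: k => [|k IH]; first by rewrite B0 subr0 /r expr0 mulr1 ltrDl.
  have [_ pg] := gP (k, a k - B k) IH; rewrite /= in pg.
  have -> : a k.+1 - B k.+1 = (a k.+1 - a k) + (a k - B k - g (k, a k - B k)).
    by rewrite BS opprD !addrA subrK.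
  rewrite (le_lt_trans (seminormD sn _ _)) //.
  rewrite (le_lt_trans (lerD (a_fast k) pg)) // /r exprS.
  have : 0 < (2^-1 : R) ^+ k by rewrite exprn_gt0 // invr_gt0.
  by move: (2^-1 ^+ k) => q q0; nra.
have Bg k i j : nrm (mx (B k.+1) i j - mx (B k) i j) <= 4 * r k.
  by have [gE _] := gP (k, a k - B k) (aB k); rewrite BS mxD addrC addKr.
have D80 : 0 <= 8 * D by rewrite mulr_ge0 // ltW.
have r_small e : 0 < e -> exists k, 8 * r k <= e.
  by move=> e0; have [N NP] := geometric_small D80 e0; exists N; rewrite mulrA NP.
(* The increments [4 * r j] for [j >= k] add up to [8 * r k]. *)
have [l lP] : exists l : matr H, forall i j k, nrm (l i j - mx (B k) i j) <= 8 * r k.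
  have lim i j : exists l, forall k, nrm (l - mx (B k) i j) <= 8 * r k.
    have [|||l lP] := @dominated_increments_cvg _ _ (fun k => mx (B k) i j)
      (fun k => - (8 * r k)) 0 (@homs_complete R H T i j).
    - by move=> k; rewrite (le_trans (Bg _ _ _)) // opprK /r exprS; have := r0 k; rewrite /r; lra.
    - by move=> e /r_small[N NP]; exists N; rewrite sub0r opprK.
    - by move=> k; rewrite oppr_le0 mulr_ge0 // ltW.
    by exists l => k; rewrite (le_trans (lP k)) // sub0r opprK.
  by exists (fun i j => sval (cid (lim i j))) => i j k; exact: (svalP (cid (lim i j))).
have lG : l \in graded K n m.
  apply/gradedP; split=> i j.
    apply: (ideal_approx Ki) => e /r_small[k ke].
    by exists (mx (B k) i j); [exact: mx_mem | exact: le_trans (lP _ _ _) ke].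
  move=> lij; apply: contrapT => ij; move/eqP: lij; apply.
  apply: nrm_le0; apply/ler_addgt0Pr => e /r_small[k ke]; rewrite add0r.
  have Bk0 : mx (B k) i j = 0.
    apply/eqP/negPn/negP => Bij; apply: ij.
    by have /gradedP[_ /(_ _ _ Bij)] := mxP (B k).
  by have := lP i j k; rewrite Bk0 subr0 => /le_trans; apply.
exists (MSpace lG) => e e0.
(* [l - B k] contributes [(m + 1) * 8 * r k] by [norm_J_entries], and [a k - B k] contributes
   [r k]. *)
pose C := (m.+1%:R * 8 + 1) * D.
have C0 : 0 <= C by rewrite mulr_ge0 // ltW.
have [N NP] := geometric_small C0 e0; exists N => k /NP; apply: le_trans.
have -> : MSpace lG - a k = (MSpace lG - B k) - (a k - B k).
  by rewrite opprB addrA subrK.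
rewrite (le_trans (seminormD sn _ _)) // (seminormN sn).
rewrite /C -mulrA mulrDl mul1r -mulrA lerD //; last exact: ltW.
apply: norm_J_entries; first by rewrite mulr_ge0 // (ltW (r0 k)).
by move=> i j; rewrite mxD mxN; exact: lP.
Qed.

End Completeness.

(** * The quotient precategory *)

Section QuotientPrecategory.
Variables (R : realType) (H : nat -> nat -> normedModType R[i]).
Variables (T : cstar_precat H) (t : right_tensoring T) (J K : ideal T).
Local Notation Ji := (idealP J).
Local Notation Ki := (idealP K).
Local Notation p := (norm_J t J).
Local Notation hN := (fun n m => @norm_J_seminorm R H T t J K n m).
Local Notation KJ := (K_J hN).

Definition kclass n m (a : Mspace K n m) : KJ n m := seminorm_class (hN n m) a.
Definition krepr n m (u : KJ n m) : Mspace K n m :=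
  repr (u : seminorm_quot (hN n m)).

Lemma kreprK n m (u : KJ n m) : kclass (krepr u) = u.
Proof. exact: seminorm_class_repr. Qed.

Lemma kclass_surj n m (u : KJ n m) : exists a, u = kclass a.
Proof. by exists (krepr u); rewrite kreprK. Qed.

Lemma kclassP n m (a b : Mspace K n m) : kclass a = kclass b <-> p (a - b) = 0.
Proof. exact: seminorm_class_eqP. Qed.

Lemma kclass_linear c n m (a b : Mspace K n m) :
  kclass (c *: a + b) = c *: kclass a + kclass b.
Proof.
rewrite /kclass seminorm_classD; congr (_ + _).
exact/esym/seminorm_quot_scaleE.
Qed.

Lemma kclassB n m (a b : Mspace K n m) : kclass (a - b) = kclass a - kclass b.
Proof.
by rewrite -[- b]scaleN1r addrC kclass_linear scaleN1r addrC.
Qed.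

Lemma norm_kclass n m (a : Mspace K n m) : `|kclass a| = (p a)%:C%C.
Proof. exact: seminorm_quot_normE. Qed.

Lemma nrm_kclass n m (a : Mspace K n m) : nrm (kclass a) = p a.
Proof. by rewrite /nrm norm_kclass. Qed.

(** Laws of the quotient are checked on partial sums, where products are compositions in [T]. *)
Lemma kclass_ext n m (a b : Mspace K n m) :
  (forall u v, (u + m = n + v)%N -> psum t (mx a) u v = psum t (mx b) u v) ->
  kclass a = kclass b.
Proof.
move=> ab; apply/kclassP; rewrite -[RHS](seminorm0 (hN n m)).
by apply: norm_J_ext => u v uv; rewrite mxD mxN psumB ab // subrr psum0.
Qed.

Definition kcomp n m l (u : KJ n m) (v : KJ m l) : KJ n l :=
  kclass (mmul t (krepr u) (krepr v)).
Definition kstar n m (u : KJ n m) : KJ m n := kclass (mstar (krepr u)).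
Definition ktens n m (u : KJ n m) : KJ n.+1 m.+1 := kclass (mincl (krepr u)).

Lemma norm_krepr n m (a : Mspace K n m) : p (krepr (kclass a) - a) = 0.
Proof. by apply/kclassP; rewrite kreprK. Qed.

(** On partial sums [a' b' - a b = (a' - a) b' + a (b' - b)], and both terms have seminorm 0. *)
Lemma kcompE n m l (a : Mspace K n m) (b : Mspace K m l) :
  kcomp (kclass a) (kclass b) = kclass (mmul t a b).
Proof.
apply/kclassP; set a' := krepr _; set b' := krepr _.
have -> : p (mmul t a' b' - mmul t a b) = p (mmul t (a' - a) b' + mmul t a (b' - b)).
  apply: norm_J_ext => u v uv; rewrite !mxD mxN psumB psumD.
  have [lm|lm] := leqP l (v + m); last by rewrite !psum_mmul_eq0 // subrr addr0.
  rewrite !(@psum_mmul _ _ _ _ _ _ _ _ _ _ _ (v + m - l)); try lia.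
  rewrite !mxD !mxN !psumB.
  by rewrite hcompBl hcompBr addrA subrK.
apply: le_anti; rewrite norm_J_ge0 andbT.
rewrite (le_trans (seminormD (hN _ _) _ _)) //.
rewrite (le_trans (lerD (norm_J_mmul _ _ _ _) (norm_J_mmul _ _ _ _))) //.
by rewrite !norm_krepr mul0r mulr0 addr0.
Qed.

Lemma kstarE n m (a : Mspace K n m) : kstar (kclass a) = kclass (mstar a).
Proof.
apply/kclassP; set a' := krepr _.
have -> : mstar a' - mstar a = mstar (a' - a).
  by apply: val_inj; apply: matrP => i j; exact/esym/hstarB.
by rewrite norm_J_mstar norm_krepr.
Qed.

Lemma ktensE n m (a : Mspace K n m) : ktens (kclass a) = kclass (mincl a).
Proof.
apply/kclassP; set a' := krepr _.
have -> : mincl a' - mincl a = mincl (a' - a) by exact: val_inj.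
by apply: le_anti; rewrite norm_J_ge0 andbT (le_trans (norm_J_mincl _ _ _)) ?norm_krepr.
Qed.

Lemma kcomplete n m (F : set_system (KJ n m)) : ProperFilter F -> cauchy F -> cvg F.
Proof.
apply: complete_of_fast_cauchy => x xfast.
have [|l lP] := @norm_J_complete _ _ _ t J K n m (fun k => krepr (x k)).
  by move=> k; rewrite -nrm_kclass kclassB !kreprK.
exists (kclass l) => e /lP[N NP]; exists N => k /NP.
by rewrite -nrm_kclass kclassB kreprK.
Qed.

Lemma kcomp_linearl n m l c (u u' : KJ n m) (v : KJ m l) :
  kcomp (c *: u + u') v = c *: kcomp u v + kcomp u' v.
Proof.
have [a ->] := kclass_surj u; have [a' ->] := kclass_surj u'.
have [b ->] := kclass_surj v.
rewrite -kclass_linear !kcompE -kclass_linear; apply: kclass_ext => i j ij.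
rewrite mxD mxZ psum_linear.
have [lm|lm] := leqP l (j + m); last by rewrite !psum_mmul_eq0 // scaler0 addr0.
rewrite !(@psum_mmul _ _ _ _ _ _ _ _ _ _ _ (j + m - l)); try lia.
by rewrite mxD mxZ psum_linear hcomp_linearl.
Qed.

Lemma kcomp_linearr n m l c (u : KJ n m) (v v' : KJ m l) :
  kcomp u (c *: v + v') = c *: kcomp u v + kcomp u v'.
Proof.
have [a ->] := kclass_surj u; have [b ->] := kclass_surj v.
have [b' ->] := kclass_surj v'.
rewrite -kclass_linear !kcompE -kclass_linear; apply: kclass_ext => i j ij.
rewrite mxD mxZ psum_linear.
have [lm|lm] := leqP l (j + m); last by rewrite !psum_mmul_eq0 // scaler0 addr0.
rewrite !(@psum_mmul _ _ _ _ _ _ _ _ _ _ _ (j + m - l)); try lia.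
by rewrite mxD mxZ psum_linear hcomp_linearr.
Qed.

Lemma kcompA n m l k (u : KJ n m) (v : KJ m l) (w : KJ l k) :
  kcomp u (kcomp v w) = kcomp (kcomp u v) w.
Proof.
have [a ->] := kclass_surj u; have [b ->] := kclass_surj v.
have [c ->] := kclass_surj w; rewrite !kcompE; apply: kclass_ext => i j ij.
(* The middle indices [j + l - k] and [j + m - k] may fail to be natural; in each such case both
   sides vanish. *)
have [kl|kl] := leqP k (j + l); last first.
  rewrite [RHS]psum_mmul_eq0 //; have [km|km] := leqP k (j + m); last by rewrite psum_mmul_eq0.
  rewrite (@psum_mmul _ _ _ _ _ _ _ _ _ _ _ (j + m - k)); [|lia|lia].
  by rewrite psum_mmul_eq0 // hcomp0r.
have [km|km] := leqP k (j + m); last first.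
  rewrite [LHS]psum_mmul_eq0 // (@psum_mmul _ _ _ _ _ _ _ _ _ _ _ (j + l - k)); [|lia|lia].
  by rewrite psum_mmul_eq0 ?hcomp0l //; lia.
rewrite [LHS](@psum_mmul _ _ _ _ _ _ _ _ _ _ _ (j + m - k)); [|lia|lia].
rewrite [RHS](@psum_mmul _ _ _ _ _ _ _ _ _ _ _ (j + l - k)); [|lia|lia].
rewrite [X in hcomp _ _ X](@psum_mmul _ _ _ _ _ _ _ _ _ _ _ (j + l - k)); [|lia|lia].
rewrite [X in _ = hcomp _ X _](@psum_mmul _ _ _ _ _ _ _ _ _ _ _ (j + m - k)); [|lia|lia].
by rewrite hcompA.
Qed.

Lemma kcomp_norm n m l (u : KJ n m) (v : KJ m l) : `|kcomp u v| <= `|u| * `|v|.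
Proof.
have [a ->] := kclass_surj u; have [b ->] := kclass_surj v.
by rewrite kcompE !norm_kclass -rmorphM lecR norm_J_mmul.
Qed.

Lemma kstar_antilinear n m c (u v : KJ n m) :
  kstar (c *: u + v) = c^* *: kstar u + kstar v.
Proof.
have [a ->] := kclass_surj u; have [b ->] := kclass_surj v.
rewrite -kclass_linear !kstarE -kclass_linear; congr kclass; apply: val_inj.
by apply: matrP => i j; exact: hstar_antilinear.
Qed.

Lemma kstarK n m (u : KJ n m) : kstar (kstar u) = u.
Proof. by have [a ->] := kclass_surj u; rewrite !kstarE mstarK. Qed.

Lemma kstar_comp n m l (u : KJ n m) (v : KJ m l) :
  kstar (kcomp u v) = kcomp (kstar v) (kstar u).
Proof.
have [a ->] := kclass_surj u; have [b ->] := kclass_surj v.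
rewrite !(kcompE, kstarE); apply: kclass_ext => i j ij; rewrite psum_mstar.
have [lm|lm] := leqP l (i + m); last first.
  by rewrite !psum_mmul_eq0 ?hstar0 //; lia.
rewrite !(@psum_mmul _ _ _ _ _ _ _ _ _ _ _ (i + m - l)); try lia.
by rewrite hstar_comp !psum_mstar.
Qed.

Lemma kcstar_identity n m (u : KJ n m) : `|kcomp (kstar u) u| = `|u| ^+ 2.
Proof.
have [a ->] := kclass_surj u.
by rewrite kstarE kcompE !norm_kclass -rmorphXn norm_J_cstar.
Qed.

Definition K_J_precat : cstar_precat KJ :=
  CstarPrecat kcomplete kcomp_linearl kcomp_linearr kcompA kcomp_norm
    kstar_antilinear kstarK kstar_comp kcstar_identity.

Lemma ktens_linear n m : linear (@ktens n m).
Proof.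
move=> c u v; have [a ->] := kclass_surj u; have [b ->] := kclass_surj v.
by rewrite -kclass_linear !ktensE -kclass_linear; congr kclass; exact: val_inj.
Qed.

HB.instance Definition _ n m :=
  GRing.isLinear.Build R[i] (KJ n m) (KJ n.+1 m.+1) *:%R (@ktens n m) (@ktens_linear n m).

Lemma ktens_hcomp n m l (u : KJ n m) (v : KJ m l) :
  ktens (kcomp u v) = kcomp (ktens u) (ktens v).
Proof.
have [a ->] := kclass_surj u; have [b ->] := kclass_surj v.
by rewrite kcompE !ktensE kcompE; congr kclass; exact: val_inj.
Qed.

Lemma ktens_hstar n m (u : KJ n m) : ktens (kstar u) = kstar (ktens u).
Proof.
have [a ->] := kclass_surj u.
by rewrite kstarE !ktensE kstarE; congr kclass; exact: val_inj.
Qed.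

Definition K_J_tensoring : right_tensoring K_J_precat :=
  @RightTensoring _ _ K_J_precat (fun n m => @ktens n m : {linear KJ n m -> KJ n.+1 m.+1})
    ktens_hcomp ktens_hstar.

End QuotientPrecategory.

(** * Annihilators and faithfulness *)

Section Annihilator.
Variables (R : realType) (H : nat -> nat -> normedModType R[i]).
Variables (T : cstar_precat H) (t : right_tensoring T).
Local Notation "a ** b" := (hcomp T a b) (at level 40, left associativity).

Lemma ker_tens_compl n m l (a : H n m) (b : H m l) :
  ker_tens t b -> ker_tens t (a ** b).
Proof. by rewrite /ker_tens /= tens_hcomp => ->; rewrite hcomp0r. Qed.

Lemma ker_tens_compr n m l (a : H n m) (b : H m l) :
  ker_tens t a -> ker_tens t (a ** b).
Proof. by rewrite /ker_tens /= tens_hcomp => ->; rewrite hcomp0l. Qed.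

(** Concrete witness for [perp]; letting [l] vary provides the off-diagonal spaces and makes the
    ideal laws direct. *)
Definition annihilator (I : subfamily H) : subfamily H :=
  fun n m => [set a | forall l (b : H m l), I m l b -> a ** b = 0].

Lemma annihilator_ideal (I : subfamily H) :
  (forall n m l (a : H n m) (b : H m l), I m l b -> I n l (a ** b)) ->
  is_ideal T (annihilator I).
Proof.
move=> Il; split.
- move=> n m; apply: approx_closed => x xa l b Ib; apply: nrm_le0.
  apply/ler_addgt0Pr => e e0; rewrite add0r.
  have b1 : 0 < nrm b + 1 by rewrite ltr_wpDl ?nrm_ge0.
  have [y ya xy] := xa _ (divr_gt0 e0 b1).
  have -> : x ** b = (x - y) ** b by rewrite hcompBl (ya _ _ Ib) subr0.
  rewrite (le_trans (nrm_hcomp _ _ _)) // (le_trans (ler_wpM2r (nrm_ge0 _) xy)) //.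
  by rewrite mulrAC ler_pdivrMr // ler_wpM2l ?(ltW e0) // lerDl.
- by move=> n m l b Ib; rewrite hcomp0l.
- by move=> n m c a b Ia Ib l d Id; rewrite hcomp_linearl Ia // Ib // scaler0 addr0.
- by move=> n m l a b Ib k d Id; rewrite -hcompA Ib // hcomp0r.
- by move=> n m l a b Ia k d Id; rewrite -hcompA Ia //; exact: Il.
Qed.

(** For [b] in [I(n,l)], [b b^s] lies in [I(n,n)] and [||a b||^2 = ||a (b b^s) a^s||]. *)
Lemma annihilator_diag (I : subfamily H) n :
  (forall n m l (a : H n m) (b : H m l), I n m a -> I n l (a ** b)) ->
  (annihilator I) n n = [set a | forall b, I n n b -> a ** b = 0].
Proof.
move=> Ir; apply/seteqP; split=> a /= ha; first by move=> b; exact: ha.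
move=> l b Ib; apply: nrm_le0; rewrite -(@ler_pXn2r _ 2) ?nnegrE ?nrm_ge0 //.
rewrite -(nrm_cstarr T) hstar_comp hcompA -(hcompA _ a) ha ?hcomp0l ?nrm0 ?expr0n //.
exact: Ir.
Qed.

(** [xget] satisfies its defining property once a witness exists, and the annihilator is one. *)
Lemma perp_kerP : is_ideal T (perp T (ker_tens t)) /\
  forall n, (perp T (ker_tens t)) n n =
    [set a : H n n | forall b : H n n, ker_tens t b -> a ** b = 0].
Proof.
pose P := [set P : subfamily H | is_ideal T P /\
  forall n, P n n = [set a : H n n | forall b : H n n, ker_tens t b -> a ** b = 0]].
have [] : P (perp T (ker_tens t)) by apply: (xgetPex _); exists (annihilator (ker_tens t));
  split; [apply: annihilator_ideal => *; exact: ker_tens_compl |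
          move=> n; apply: annihilator_diag => *; exact: ker_tens_compr].
by [].
Qed.

(** If [x] is in [J] and in the kernel, [x^s x] annihilates itself, so [x = 0] by the C*-identity.
    Conversely, for [a] in [J] and [b] in the kernel, [a a^s b] lies in both, so [a a^s] is in
    [perp], and [a] follows by [ideal_of_hcomp_hstar]. *)
Lemma sub_perpP (J : ideal T) : sub_le J (perp T (ker_tens t)) <->
  forall n m (x : H n m), (J : subfamily H) n m x -> tens t n m x = 0 -> x = 0.
Proof.
have [Pi Pd] := perp_kerP; have Ji := idealP J; split=> [JP n m x Jx x0|J0 n m a Ja].
  have : (perp T (ker_tens t)) m m (hstar T x ** x) by apply: JP; exact: (ideal_compl Ji).
  rewrite Pd => /(_ (hstar T x ** x) (ker_tens_compl _ x0)) xx0.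
  have : nrm (hstar T (hstar T x ** x) ** (hstar T x ** x)) = 0.
    by rewrite hstar_comp hstarK xx0 nrm0.
  by rewrite !nrm_cstar => /eqP; rewrite !expf_eq0 /= => /eqP x00; apply: nrm_le0; rewrite x00.
apply: (ideal_of_hcomp_hstar Pi); rewrite Pd => b b0.
apply: J0; first by apply: (ideal_compr Ji); exact: (ideal_compr Ji).
exact: ker_tens_compl.
Qed.

End Annihilator.

Section LowerPartialSums.
Variables (R : realType) (H : nat -> nat -> normedModType R[i]).
Variables (T : cstar_precat H) (t : right_tensoring T).

Lemma mshift_eq0 (a : matr H) u v :
  (forall i j, (j < v)%N -> a i j = 0) -> mshift t a u v = 0.
Proof. by case: u v => [|u] [|v] av //=; rewrite av ?raddf0. Qed.

Lemma psum_eq0 (a : matr H) u v :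
  (forall i j, (j <= v)%N -> a i j = 0) -> psum t a u v = 0.
Proof.
elim: u v => [|u IH] [|v] av /=; rewrite ?av // add0r IH ?raddf0 // => i j jv.
by rewrite av // ltnW.
Qed.

End LowerPartialSums.

Theorem theorem4p11 (R : realType) (H : nat -> nat -> normedModType R[i])
    (T : cstar_precat H) (t : right_tensoring T) (J K : ideal T)
    (hJK : sub_le J K) :
  exists hN : forall n m, seminorm (@norm_J R H T t K J n m),
  exists (S : cstar_precat (K_J hN)) (tJ : right_tensoring S),
    [/\ (forall n m l (a : Mspace K n m) (b : Mspace K m l),
           exists2 c : Mspace K n l, mx c = matr_mul t (mx a) (mx b) &
             hcomp S (seminorm_class (hN n m) a) (seminorm_class (hN m l) b) =
             seminorm_class (hN n l) c),
        (forall n m (a : Mspace K n m),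
           exists2 c : Mspace K m n, mx c = matr_star T (mx a) &
             hstar S (seminorm_class (hN n m) a) = seminorm_class (hN m n) c),
        (forall n m (a : Mspace K n m),
           exists2 c : Mspace K n.+1 m.+1, mx c = mx a &
             tens tJ n m (seminorm_class (hN n m) a) =
             seminorm_class (hN n.+1 m.+1) c) &
        faithful tJ <-> sub_le J (perp T (ker_tens t))].
Proof.
exists (fun n m => @norm_J_seminorm R H T t J K n m).
exists (K_J_precat t J K), (K_J_tensoring t J K); split.
- by move=> n m l a b; exists (mmul t a b) => //; exact: kcompE.
- by move=> n m a; exists (mstar a) => //; exact: kstarE.
- by move=> n m a; exists (mincl a) => //; exact: ktensE.
have Ji := idealP J.
apply: iff_trans (iff_sym (sub_perpP t J)); split=> [fth n m x Jx x0|J0 n m u v].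
  (* Take [x] as a single entry, allowed as [J] lies in [K]. After [mincl], its partial sum in
     column [m] is [x], null modulo [J], and in column [m + 1] it is the tensoring of [x], which is
     0. Faithfulness then makes [x] null. *)
  have xE u v : single x u v = if (n == u) && (m == v) then single x u v else 0.
    by rewrite -{1}[X in single X](singleE x) single_at.
  have xG : single x \in graded K n m.
    apply/gradedP; split=> i j; rewrite xE; case: ifP => [/andP[/eqP ni /eqP mj]|_].
    - by subst i j; rewrite singleE; exact: hJK.
    - exact: (ideal0 (idealP K)).
    - by subst i j.
    - by rewrite eqxx.
  have lower u v : (v < m)%N -> psum t (single x) u v = 0.
    move=> vm; apply: psum_eq0 => i j jv; rewrite xE; case: ifP => // /andP[_ /eqP mj]; lia.
  have xx : psum t (single x) n m = x.
    by rewrite psumE singleE mshift_eq0 ?addr0 // => i j /lower ->.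
  pose a := MSpace xG.
  have : kclass t J (mincl a) = kclass t J (mincl 0).
    apply/kclassP; apply: le_anti; rewrite norm_J_ge0 andbT.
    have pE u v : psum t (mx (mincl a - mincl 0)) u v = psum t (single x) u v.
      by rewrite mxD mxN psumB psum0 subr0.
    apply/norm_J_leP => //; split=> [u v uv vm|]; rewrite pE; last first.
      by rewrite /= xx x0 xE ltn_eqF //= addr0 nrm0.
    rewrite (quotient_norm_mem Ji) //; move: vm; rewrite ltnS leq_eqVlt => /orP[/eqP vm|vm].
      have un : u = n by lia.
      by subst u v; rewrite xx.
    by rewrite lower //; exact: (ideal0 Ji).
  rewrite -!ktensE => /fth /kclassP; rewrite subr0 => pa.
  by apply: nrm_le0; rewrite -[X in nrm X]xx -pa; exact: (norm_J_nrm t J a).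
(* If [mincl c] is null for [c = a - b], every partial sum of [c] lies in [J], and the top one is
   also killed by tensoring, hence 0 by [J0]. *)
have [a ->] := kclass_surj u; have [b ->] := kclass_surj v.
rewrite /= !ktensE => /kclassP pab; apply/kclassP; set c := a - b.
have pc : norm_J t J (mincl c) <= 0.
  have -> : mincl c = mincl a - mincl b by exact: val_inj.
  by rewrite pab.
clearbody c.
apply: le_anti; rewrite norm_J_ge0 andbT; apply/norm_J_leP => //.
have qc u' v' : (u' + m = n + v')%N -> (v' <= m)%N -> quotient_norm J (psum t (mx c) u' v') <= 0.
  by move=> uv vm; apply: le_trans pc; apply: (@norm_J_quotient _ _ _ t J K _ _ (mincl c)); lia.
split=> [u' v' uv vm|]; first by apply: qc => //; exact: ltnW.
suff -> : psum t (mx c) n m = 0 by rewrite nrm0.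
apply: J0; first by apply: (quotient_norm_eq0 Ji); exact: qc.
apply: nrm_le0; apply: le_trans pc.
apply: le_trans (norm_J_nrm t J (mincl c)).
by rewrite /= mx_out // add0r.
Qed.
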